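(* Assume (A). If $d = \tilde{\omega}\big(\max(n^{3/2}p,\,n)\big)$, then $$\mathsf{TV}\Big(\mathsf{RGG}(n,\mathbb{T}^d,\mathsf{Unif},\sigma^\infty_p,p),\ \mathsf{G}(n,p)\Big) = o(1)\quad\text{as } n\to\infty.$$
   Context: Torus: $\mathbb{T}^d=\mathbb{R}^d/2\mathbb{Z}^d$, i.e. a product of $d$ circles of circumference $2$, with the uniform (Haar) probability measure $\mathsf{Unif}$. For $x,y$ on a circle of circumference 2, $|x-y|_C\in[0,1]$ is the circular distance (length of the shorter arc). For $1\le q<\infty$, $\|\mathbf{x}-\mathbf{y}\|_q=(\sum_{i=1}^d|x_i-y_i|_C^q)^{1/q}$, and $\|\mathbf{x}-\mathbf{y}\|_\infty=\max_i|x_i-y_i|_C$. For $p\in[0,1]$ and $q\in[1,\infty]$, $\tau^q_p$ is the value with $\mathbf{P}_{\mathbf{x},\mathbf{y}\text{ iid }\mathsf{Unif}}[\|\mathbf{x}-\mathbf{y}\|_q\le\tau^q_p]=p$, and $\sigma^q_p(\mathbf{x},\mathbf{y})=\mathbb{1}[\|\mathbf{x}-\mathbf{y}\|_q\le\tau^q_p]$. The random geometric graph $\mathsf{RGG}(n,\mathbb{T}^d,\mathsf{Unif},\sigma^q_p,p)$ on vertex set $[n]$: sample $\mathbf{x}^1,\dots,\mathbf{x}^n$ iid uniform on $\mathbb{T}^d$ and join $i,j$ iff $\|\mathbf{x}^i-\mathbf{x}^j\|_q\le\tau^q_p$. $\mathsf{G}(n,p)$ is the Erdős–Rényi graph. Assumption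 (A): there are absolute constants $\delta,\epsilon>0$ with $n^{-1+\epsilon}\le p\le 1/2$ and $n^\delta\le d$. The notations $\tilde o,\tilde\omega,\tilde O$ hide polylogarithmic factors in $n$. *)

(* Defs.v *)
From HB Require Import structures.
From mathcomp Require Import all_boot all_order all_algebra.
From mathcomp Require Import all_classical all_reals all_analysis.
Set Implicit Arguments. Unset Strict Implicit. Unset Printing Implicit Defensive.
Import Order.TTheory GRing.Theory Num.Theory.
Import numFieldNormedType.Exports.
Local Open Scope ring_scope.

Section RGGDefs.
Variable R : realType.

(* Uniform (Haar) probability on the torus R^I/2Z^I for a finite coordinate
   set I, realized on the fundamental domain [0,2)^I as an iterated integral
   of the normalized Lebesgue measure (1/2) dt on [0,2), one coordinate at a
   time (by Fubini-Tonelli this is the product probability measure for the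
   nonnegative measurable integrands used below). *)
Fixpoint iint (I : eqType) (s : seq I) (f : (I -> R) -> \bar R) : \bar R :=
  match s with
  | [::] => f (fun _ => 0)
  | i :: s' =>
      ((2^-1)%:E *
       \int[@lebesgue_measure R]_(t in `[0%R, 2%R[%classic)
          iint s' (fun x => f (fun j => if j == i then t else x j)))%E
  end.

Definition unif_prob (I : finType) (P : (I -> R) -> bool) : R :=
  fine (iint (enum I) (fun z => ((P z)%:R)%:E)).

(* circular distance on a circle of circumference 2, for representatives in [0,2) *)
Definition circd (x y : R) : R := Num.min `|x - y| (2 - `|x - y|).

Definition linf (d : nat) (x y : 'I_d -> R) : R :=
  \big[Num.max/0]_(k < d) circd (x k) (y k).

Definition edge_prob (d : nat) (tau : R) : R :=
  unif_prob (fun z : bool * 'I_d -> R =>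
    linf (fun k => z (false, k)) (fun k => z (true, k)) <= tau).

(* Graphs on vertex set [n] = 'I_n, given by their edge set (a set of 2-subsets). *)
Definition graph_on (n : nat) := {set {set 'I_n}}.

Definition rgg_graph (n d : nat) (tau : R) (z : 'I_n * 'I_d -> R) : graph_on n :=
  [set e : {set 'I_n} | [exists i : 'I_n, exists j : 'I_n,
     [&& (i < j)%N, e == [set i; j]%SET &
         linf (fun k => z (i, k)) (fun k => z (j, k)) <= tau]]].

Definition rgg_law (n d : nat) (tau : R) (E : graph_on n) : R :=
  unif_prob (fun z : 'I_n * 'I_d -> R => rgg_graph tau z == E).

Definition er_law (n : nat) (p : R) (E : graph_on n) : R :=
  if E \subset [set e : {set 'I_n} | #|e| == 2%N]
  then p ^+ #|E| * (1 - p) ^+ ('C(n, 2) - #|E|)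
  else 0.

Definition tv_rgg_er (n d : nat) (p tau : R) : R :=
  2^-1 * \sum_(E : graph_on n) `|rgg_law d tau E - er_law p E|.

End RGGDefs.

(* Main.v *)
Require Import Defs.
From HB Require Import structures.
From mathcomp Require Import all_boot all_order all_algebra.
From mathcomp Require Import all_classical all_reals all_analysis.
From mathcomp Require Import measurable_realfun ring lra.
Import Order.TTheory GRing.Theory Num.Theory.
Import numFieldNormedType.Exports.
Set Implicit Arguments. Unset Strict Implicit. Unset Printing Implicit Defensive.
Local Open Scope classical_set_scope.
Local Open Scope ring_scope.

(** Reveal the vertices one at a time.  By the chain rule, the relative entropy of a graph
    on random positions with respect to G(n,p) grows, when the vertex k is added, by at most
    the chi-square divergence of the k-th row of the adjacency matrix from k independent
    Bernoulli(p) variables, averaged over the positions of the earlier vertices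
    (Cauchy-Schwarz removes the conditioning on the graph seen so far).  Expanding the
    square with an independent copy of the new vertex and integrating out the k earlier
    vertices, this averaged divergence equals [E (1 + g)^k - 1], where [g] is the
    correlation, given two points x and y, of their adjacencies to a common random point.

    On the torus, write [lam = 1 - tau], so [p = (1 - lam)^d] and [lam <= ln n / d].  Since
    the metric is a maximum, [g] is an affine function of [prod_c (1 - 2 lam + m_c)], where
    [m_c] in [[0, lam]] is the probability that a uniform point of the circle is far from
    both x_c and y_c, and [E m_c = lam^2].  As [E g = 0], a second-order expansion bounds the
    divergence by [O ((k p eta)^2)] for [eta = (ln n)^2 / d], as long as [k eta <= 1];
    summing over k gives an entropy of order [(n^(3/2) p eta)^2].  The total variation
    distance is at most the square root of the entropy, hence C = 2. *)

Section QuadraticDiscriminant.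
Context (R : rcfType).

Lemma quadratic_ge0_sqr_le (a b c : R) :
  (forall x, 0 <= a * x ^+ 2 + 2 * b * x + c) -> b ^+ 2 <= a * c.
Proof.
move=> quad_ge0; pose q := Poly [:: c; 2 * b; a].
have : q`_1 ^+ 2 - 4 * q`_2 * q`_0 <= 0.
  apply: deg_le2_poly_ge0 => [|x]; first exact: size_Poly.
  by rewrite horner_Poly /= (_ : _ + c = a * x ^+ 2 + 2 * b * x + c); [exact: quad_ge0|ring].
by rewrite !coefE /=; lra.
Qed.

Lemma sum_cauchy_schwarz (S : finType) (f g : S -> R) :
  (\sum_s f s * g s) ^+ 2 <= (\sum_s f s ^+ 2) * (\sum_s g s ^+ 2).
Proof.
apply: quadratic_ge0_sqr_le => x.
have -> : (\sum_s f s ^+ 2) * x ^+ 2 + 2 * (\sum_s f s * g s) * x + \sum_s g s ^+ 2 =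
    \sum_s (f s * x + g s) ^+ 2.
  rewrite mulr_suml mulr_sumr mulr_suml -!big_split /=.
  by apply: eq_bigr => s _; ring.
by apply: sumr_ge0 => s _; exact: sqr_ge0.
Qed.

End QuadraticDiscriminant.

Lemma onerfctE (T : Type) (K : pzRingType) : 1 = cst 1 :> (T -> K).
Proof. by []. Qed.

Section UpdateOneCoordinate.
Context (I : eqType) (T : I -> Type).
Implicit Type z : forall i, T i.

Lemma dfwithC z i j (t : T i) (u : T j) : i != j ->
  dfwith (dfwith z i t) j u = dfwith (dfwith z j u) i t.
Proof.
move=> ij; apply/functional_extensionality_dep => k.
have [jk|jk] := eqVneq j k; first by case: k / jk; rewrite dfwithin dfwithout// dfwithin.
rewrite dfwithout//; have [ik|ik] := eqVneq i k.
  by case: k / ik jk => jk; rewrite !dfwithin.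
by rewrite !dfwithout.
Qed.

End UpdateOneCoordinate.

Section CoordinateDependence.
Context (R : realType) (I : eqType) (X : Type).
Implicit Types (f g : (I -> X) -> R) (z : I -> X) (D : {pred I}).

Definition depends_on D : {pred (I -> X) -> R} :=
  mem [set f | forall z z', {in D, z =1 z'} -> f z = f z'].

Lemma depends_onP D f :
  f \in depends_on D <-> forall z z', {in D, z =1 z'} -> f z = f z'.
Proof. by rewrite inE. Qed.

Lemma depends_on_subring_closed D : subring_closed (depends_on D).
Proof.
split=> [|f g /depends_onP fD /depends_onP gD|f g /depends_onP fD /depends_onP gD].
- exact/depends_onP.
- by apply/depends_onP => z z' zz'; rewrite !fctE (fD _ _ zz') (gD _ _ zz').
- by apply/depends_onP => z z' zz'; rewrite !fctE (fD _ _ zz') (gD _ _ zz').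
Qed.
HB.instance Definition _ D := GRing.isSubringClosed.Build _ (depends_on D)
  (depends_on_subring_closed D).

Lemma depends_onS D D' f : {subset D <= D'} -> f \in depends_on D -> f \in depends_on D'.
Proof.
move=> DD' /depends_onP fD; apply/depends_onP => z z' zz'.
by apply: fD => i /DD'; exact: zz'.
Qed.

Lemma depends_on_cst D (c : R) : cst c \in depends_on D.
Proof. exact/depends_onP. Qed.

Lemma depends_on_dfwith D f z i t : f \in depends_on D -> i \notin D ->
  f (dfwith z i t) = f z.
Proof.
move=> /depends_onP fD iD; apply: fD => j jD.
by rewrite dfwithout//; apply: contraNneq iD => ->.
Qed.

End CoordinateDependence.

(** * Averages over coordinates *)

Section MeasurableRelation.
Context (dX : measure_display) (X : measurableType dX).

Definition measurable_rel (nbr : X -> X -> bool) := forall (d : measure_display)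
  (T : measurableType d) (f g : T -> X), measurable_fun setT f -> measurable_fun setT g ->
  measurable_fun setT (fun t => nbr (f t) (g t)).

Definition jointly_measurable_rel (C : Type) (link : (C -> X) -> (C -> X) -> bool) :=
  forall (d : measure_display) (T : measurableType d) (f g : C -> T -> X),
  (forall c, measurable_fun setT (f c)) -> (forall c, measurable_fun setT (g c)) ->
  measurable_fun setT (fun t => link (f ^~ t) (g ^~ t)).

Lemma measurable_bool_natr (R : realType) (e : X -> bool) : measurable_fun setT e ->
  measurable_fun setT (fun t => (e t)%:R : R).
Proof.
move=> me; rewrite (_ : (fun t => _) = fun t => if e t then 1 else 0).
  exact: measurable_fun_ifT.
by apply/funext => t; case: (e t).
Qed.

End MeasurableRelation.

Section BoundedMeasurable.
Context (R : realType) (dX : measure_display) (X : measurableType dX) (I : eqType).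
Implicit Types (f g : (I -> X) -> R) (z : I -> X).

(* Measurability for the product sigma-algebra on [I -> X], tested along all measurable
   families of coordinates, so that this sigma-algebra need not be constructed. *)
Definition jointly_measurable f := forall (d : measure_display) (T : measurableType d)
  (g : I -> T -> X), (forall i, measurable_fun setT (g i)) ->
  measurable_fun setT (fun t => f (g ^~ t)).

Definition bmeasurable : {pred (I -> X) -> R} :=
  mem [set f | jointly_measurable f /\ exists M : R, forall z, `|f z| <= M].

Lemma bmeasurableP f : f \in bmeasurable <->
  jointly_measurable f /\ exists M : R, forall z, `|f z| <= M.
Proof. by rewrite inE. Qed.

Lemma bmeasurable_cst (c : R) : cst c \in bmeasurable.
Proof. by apply/bmeasurableP; split; [move=> *; exact: measurable_cst|exists `|c|]. Qed.

Lemma bmeasurable_subring_closed : subring_closed bmeasurable.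
Proof.
split=> [|f g|f g]; first exact: bmeasurable_cst.
- move=> /bmeasurableP[mf [M fM]] /bmeasurableP[mg [N gN]]; apply/bmeasurableP; split.
    by move=> d T h mh; apply: measurable_funB; [exact: mf|exact: mg].
  by exists (M + N) => z; rewrite (le_trans (ler_normB _ _))// lerD.
- move=> /bmeasurableP[mf [M fM]] /bmeasurableP[mg [N gN]]; apply/bmeasurableP; split.
    by move=> d T h mh; apply: measurable_funM; [exact: mf|exact: mg].
  by exists (M * N) => z; rewrite normrM ler_pM.
Qed.
HB.instance Definition _ := GRing.isSubringClosed.Build _ bmeasurable
  bmeasurable_subring_closed.

Lemma measurable_dfwith z i j : measurable_fun setT (fun t : X => dfwith z i t j).
Proof.
have [<-|ij] := eqVneq i j.
  by rewrite (_ : (fun t => _) = id)//; apply/funext => t; rewrite dfwithin.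
by rewrite (_ : (fun t => _) = cst (z j))//; apply/funext => t; rewrite dfwithout.
Qed.

Lemma bmeasurable_dfwith f i t :
  f \in bmeasurable -> (fun z => f (dfwith z i t)) \in bmeasurable.
Proof.
move=> /bmeasurableP[mf [M fM]]; apply/bmeasurableP; split; last by exists M.
move=> d T g mg; apply: (mf _ _ (fun j u => dfwith (g ^~ u) i t j)) => j.
have [<-|ij] := eqVneq i j.
  by rewrite (_ : (fun u => _) = cst t)//; apply/funext => u; rewrite dfwithin.
by rewrite (_ : (fun u => _) = g j)//; apply/funext => u; rewrite dfwithout.
Qed.

Lemma measurable_dfwith_pair (d : measure_display) (T : measurableType d)
    (g : I -> T -> X) i j : (forall i, measurable_fun setT (g i)) ->
  measurable_fun setT (fun tu : T * X => dfwith (g ^~ tu.1) i tu.2 j).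
Proof.
move=> mg; have [<-|ij] := eqVneq i j.
  by rewrite (_ : (fun t => _) = snd)//; apply/funext => t; rewrite dfwithin.
rewrite (_ : (fun t => _) = g j \o fst); first exact: measurableT_comp.
by apply/funext => t; rewrite dfwithout.
Qed.

End BoundedMeasurable.

Arguments bmeasurable {R dX X I}.

HB.lock Definition avg (R : realType) (dX : measure_display) (X : measurableType dX)
    (P : probability X R) (I : eqType) (i : I) (f : (I -> X) -> R) : (I -> X) -> R :=
  fun z => \int[P]_t f (dfwith z i t).
Canonical avg_unlockable := Unlockable avg.unlock.

Section CoordinateAverage.
Context (R : realType) (dX : measure_display) (X : measurableType dX).
Variables (P : probability X R) (I : eqType).
Implicit Types (f g : (I -> X) -> R) (z : I -> X) (D : {pred I}) (s : seq I).

Local Notation avg := (@avg R dX X P I).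

Lemma avgE i f z : avg i f z = \int[P]_t f (dfwith z i t).
Proof. by rewrite unlock. Qed.

Lemma integrable_dfwith f z i : f \in bmeasurable ->
  P.-integrable setT (EFin \o (fun t => f (dfwith z i t))).
Proof.
move=> /bmeasurableP[mf [M fM]]; apply: measurable_bounded_integrable => //.
- by rewrite (le_lt_trans (probability_le1 _ _))// ltry.
- by apply: (mf _ _ (fun j t => dfwith z i t j)) => j; exact: measurable_dfwith.
- by exists M; split; [exact: num_real|move=> x Mx t _; exact: le_trans (fM _) (ltW Mx)].
Qed.

Lemma EFin_avg f z i : f \in bmeasurable ->
  (avg i f z)%:E = (\int[P]_t (f (dfwith z i t))%:E)%E.
Proof.
by move=> mf; rewrite avgE fineK//; exact: integrable_fin_num (integrable_dfwith _ _ mf).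
Qed.

Lemma avg_cst (c : R) i : avg i (cst c) = cst c.
Proof.
by apply/funext => z; rewrite avgE Rintegral_cst// [X in fine X]probability_setT mulr1.
Qed.

Lemma avgD f g i : f \in bmeasurable -> g \in bmeasurable ->
  avg i (f + g) = avg i f + avg i g.
Proof.
move=> mf mg; apply/funext => z; rewrite !addrfctE !avgE.
by rewrite -RintegralD//; exact: integrable_dfwith.
Qed.

Lemma avgM D f g i : f \in depends_on D -> i \notin D -> g \in bmeasurable ->
  avg i (f * g) = f * avg i g.
Proof.
move=> fD iD mg; apply/funext => z; rewrite !mulrfctE !avgE /=.
under eq_Rintegral do rewrite (depends_on_dfwith _ _ fD iD).
by rewrite RintegralZl//; exact: integrable_dfwith.
Qed.

Lemma avg_le f g i : f \in bmeasurable -> g \in bmeasurable -> (forall z, f z <= g z) ->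
  forall z, avg i f z <= avg i g z.
Proof.
by move=> mf mg fg z; rewrite !avgE; apply: le_Rintegral => //; exact: integrable_dfwith.
Qed.

Lemma depends_on_avg D f i : f \in depends_on [predU1 i & D] -> avg i f \in depends_on D.
Proof.
move=> /depends_onP fD; apply/depends_onP => z z' zz'.
rewrite !avgE; apply: eq_Rintegral => t _; apply: fD => j; rewrite !inE.
have [->|ji] := eqVneq j i; first by rewrite !dfwithin.
by rewrite !dfwithout 1?eq_sym// => /zz'.
Qed.

Lemma bmeasurable_avg f i : f \in bmeasurable -> avg i f \in bmeasurable.
Proof.
move=> fbm; have /bmeasurableP[mf [M fM]] := fbm.
have Mbm := @bmeasurable_cst R _ X I; have fMbm z : - M <= f z <= M by rewrite -ler_norml.
apply/bmeasurableP; split; last first.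
  exists M => z; rewrite ler_norml; apply/andP; split.
  - have := avg_le i (Mbm (- M)) fbm _ z; rewrite avg_cst; apply.
    by move=> z'; have /andP[] := fMbm z'.
  - have := avg_le i fbm (Mbm M) _ z; rewrite avg_cst; apply.
    by move=> z'; have /andP[] := fMbm z'.
move=> d T g mg.
(* Shifting by [M] reduces to the nonnegative case of Tonelli. *)
pose h (tu : T * X) := (f (dfwith (g ^~ tu.1) i tu.2) + M)%:E.
have mh : measurable_fun setT h.
  apply/measurable_EFinP/measurable_funD => //.
  apply: (mf _ _ (fun j (tu : T * X) => dfwith (g ^~ tu.1) i tu.2 j)) => j.
  exact: measurable_dfwith_pair.
have h_ge0 tu : (0 <= h tu)%E.
  by rewrite lee_fin; have /andP[] := fMbm (dfwith (g ^~ tu.1) i tu.2); lra.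
rewrite (_ : (fun t => _) = (fun t => fine (fubini_F P h t) - M)).
  by apply: measurable_funB => //; apply: measurableT_comp => //;
    exact: measurable_fun_fubini_tonelli_F.
apply/funext => t; have -> : fubini_F P h t = (avg i (f + cst M) (g ^~ t))%:E.
  by rewrite EFin_avg ?rpredD.
by rewrite avgD// avg_cst fctE addrK.
Qed.

Lemma avgC_ge0 f i j : f \in bmeasurable -> (forall z, 0 <= f z) ->
  avg i (avg j f) = avg j (avg i f).
Proof.
move=> fbm f_ge0; have /bmeasurableP[mf _] := fbm.
have [->//|ij] := eqVneq i j.
apply/funext => z; apply: EFin_inj; rewrite !EFin_avg ?bmeasurable_avg//.
under eq_integral do rewrite EFin_avg//.
under [RHS]eq_integral do rewrite EFin_avg//.
rewrite (@fubini_tonelli _ _ _ _ _ P P (fun tu => (f (dfwith (dfwith z i tu.1) j tu.2))%:E)).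
- by apply: eq_integral => t _; apply: eq_integral => u _; rewrite /= dfwithC.
- apply/measurable_EFinP.
  apply: (mf _ _ (fun k (tu : X * X) => dfwith (dfwith z i tu.1) j tu.2 k)) => k.
  by apply: (measurable_dfwith_pair (g := fun k t => dfwith z i t k)) => k';
    exact: measurable_dfwith.
- by move=> tu; rewrite lee_fin.
Qed.

Lemma avgC f i j : f \in bmeasurable -> avg i (avg j f) = avg j (avg i f).
Proof.
move=> fbm; have /bmeasurableP[_ [M fM]] := fbm.
have Mbm : cst M \in @bmeasurable R _ X I by exact: bmeasurable_cst.
have fM_ge0 z : 0 <= (f + cst M) z.
  by rewrite !fctE; have := fM z; rewrite ler_norml => /andP[]; lra.
have := avgC_ge0 i j (rpredD fbm Mbm) fM_ge0.
by rewrite !(avgD, avg_cst) ?bmeasurable_avg// => /addIr.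
Qed.

Definition avgs s f := foldr avg f s.

Lemma avgs_cat s1 s2 f : avgs (s1 ++ s2) f = avgs s1 (avgs s2 f).
Proof. exact: foldr_cat. Qed.

Lemma bmeasurable_avgs s f : f \in bmeasurable -> avgs s f \in bmeasurable.
Proof. by move=> mf; elim: s => //= i s; exact: bmeasurable_avg. Qed.

Lemma avgs_cst s (c : R) : avgs s (cst c) = cst c.
Proof. by elim: s => //= i s ->; exact: avg_cst. Qed.

Lemma avgsD s f g : f \in bmeasurable -> g \in bmeasurable ->
  avgs s (f + g) = avgs s f + avgs s g.
Proof. by move=> mf mg; elim: s => //= i s ->; rewrite avgD// bmeasurable_avgs. Qed.

Lemma avgsM D s f g : f \in depends_on D -> {in s, forall i, i \notin D} ->
  g \in bmeasurable -> avgs s (f * g) = f * avgs s g.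
Proof.
move=> fD sD mg; elim: s sD => //= i s ih sD.
rewrite ih => [|j js]; last by apply: sD; rewrite inE js orbT.
by rewrite (avgM fD)// ?sD ?mem_head// bmeasurable_avgs.
Qed.

Lemma avgsZ s (c : R) f : f \in bmeasurable -> avgs s (cst c * f) = cst c * avgs s f.
Proof. by move=> mf; apply: (avgsM (depends_on_cst _ pred0 c)). Qed.

Lemma avgsB s f g : f \in bmeasurable -> g \in bmeasurable ->
  avgs s (f - g) = avgs s f - avgs s g.
Proof.
have NE f' : - f' = cst (-1) * f' :> ((I -> X) -> R) by rewrite -[LHS]mulN1r.
by move=> mf mg; rewrite avgsD ?rpredN// (NE g) avgsZ// -NE.
Qed.

Lemma avgs_sum s (J : Type) (r : seq J) (F : J -> (I -> X) -> R) :
  (forall j, F j \in bmeasurable) ->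
  avgs s (\sum_(j <- r) F j) = \sum_(j <- r) avgs s (F j).
Proof.
move=> mF; elim: r => [|j r ih]; first by rewrite !big_nil avgs_cst.
by rewrite !big_cons avgsD ?rpred_sum// ih.
Qed.

Lemma avgs_le s f g : f \in bmeasurable -> g \in bmeasurable -> (forall z, f z <= g z) ->
  forall z, avgs s f z <= avgs s g z.
Proof.
by move=> mf mg fg; elim: s => //= i s ih z; apply: avg_le; rewrite ?bmeasurable_avgs.
Qed.

Lemma avgs_ge0 s f : f \in bmeasurable -> (forall z, 0 <= f z) -> forall z, 0 <= avgs s f z.
Proof.
move=> mf f_ge0 z.
by have := avgs_le s (bmeasurable_cst _ _ 0) mf f_ge0 z; rewrite avgs_cst.
Qed.

Lemma avgs_le_cst s f (c : R) : f \in bmeasurable -> (forall z, f z <= c) ->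
  forall z, avgs s f z <= c.
Proof.
move=> mf fc z.
by have := avgs_le s mf (bmeasurable_cst _ _ c) fc z; rewrite avgs_cst.
Qed.

Lemma avgsC s1 s2 f : f \in bmeasurable -> avgs s1 (avgs s2 f) = avgs s2 (avgs s1 f).
Proof.
move=> mf; have avg_avgs i s g : g \in bmeasurable -> avgs s (avg i g) = avg i (avgs s g).
  by move=> mg; elim: s => //= j s ->; rewrite avgC ?bmeasurable_avgs.
by elim: s1 => //= i s1 ->; rewrite avg_avgs ?bmeasurable_avgs.
Qed.

Lemma avgs_dfwith s f i t z : i \notin s ->
  avgs s (fun z => f (dfwith z i t)) z = avgs s f (dfwith z i t).
Proof.
elim: s z => //= j s ih z; rewrite inE negb_or => /andP[ij nis]; rewrite !avgE.
by apply: eq_Rintegral => u _; rewrite ih// dfwithC// eq_sym.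
Qed.

Lemma perm_avgs s1 s2 f : f \in bmeasurable -> perm_eq s1 s2 -> avgs s1 f = avgs s2 f.
Proof.
move=> mf p12; apply: (catCA_perm_subst (F := fun s => avgs s f) _ p12) => s t u.
by rewrite !avgs_cat avgsC// bmeasurable_avgs.
Qed.

Lemma depends_on_avgs s D f :
  f \in depends_on [predU D & mem s] -> avgs s f \in depends_on D.
Proof.
elim: s D => [|i s ih] D fD /=.
  by apply: depends_onS fD => i; rewrite !inE orbF.
apply/depends_on_avg/ih; apply: depends_onS fD => j.
by rewrite !inE orbCA orbA.
Qed.

Lemma avgs_prod (J : eqType) (r : seq J) (s : J -> seq I) (D : J -> {pred I})
    (F : J -> (I -> X) -> R) : uniq r ->
  (forall j, F j \in bmeasurable) -> (forall j, F j \in depends_on (D j)) ->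
  {in r &, forall j k, j != k -> {in s j, forall i, i \notin D k}} ->
  avgs (flatten [seq s j | j <- r]) (\prod_(j <- r) F j) = \prod_(j <- r) avgs (s j) (F j).
Proof.
move=> r_uniq mF FD; elim: r r_uniq => [_ _|j r ih /= /andP[jr r_uniq] disj].
  by rewrite !big_nil avgs_cst.
have neq_j k : k \in r -> k != j by apply: contraTneq => ->.
rewrite !big_cons avgs_cat (avgsM (FD j)) ?rpred_prod//; last first.
  move=> i /flatten_mapP[k kr]; apply: disj; rewrite ?mem_head ?inE ?kr ?orbT//.
  exact: neq_j.
rewrite ih => [|//|k l kr lr]; last by apply: disj; rewrite inE ?kr ?lr orbT.
have dep_r : \prod_(k <- r) avgs (s k) (F k) \in depends_on (predC (mem (s j))).
  rewrite big_seq; apply: rpred_prod => k kr; apply: depends_on_avgs.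
  apply: depends_onS (FD k) => i iDk; rewrite !inE.
  apply/orP; left; apply: contraTN iDk => ij.
  by apply: (disj j k); rewrite ?mem_head ?in_cons ?kr ?orbT 1?eq_sym ?neq_j.
rewrite mulrC [RHS]mulrC; apply: (avgsM dep_r) => // i.
by rewrite inE negbK.
Qed.

Lemma avgs_cauchy_schwarz s f g z : f \in bmeasurable -> g \in bmeasurable ->
  avgs s (f * g) z ^+ 2 <= avgs s (f ^+ 2) z * avgs s (g ^+ 2) z.
Proof.
move=> mf mg; apply: quadratic_ge0_sqr_le => x.
have mcst (c : R) : cst c \in @bmeasurable R _ X I := bmeasurable_cst _ _ c.
have -> : avgs s (f ^+ 2) z * x ^+ 2 + 2 * avgs s (f * g) z * x + avgs s (g ^+ 2) z =
    avgs s (cst (x ^+ 2) * f ^+ 2 + cst (2 * x) * (f * g) + g ^+ 2) z.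
  by rewrite !avgsD ?avgsZ ?(mcst, rpredD, rpredM, rpredX)// !fctE; ring.
apply: avgs_ge0 => [|z']; first by rewrite ?(mcst, rpredD, rpredM, rpredX).
have -> : (cst (x ^+ 2) * f ^+ 2 + cst (2 * x) * (f * g) + g ^+ 2) z' = (x * f z' + g z') ^+ 2.
  by rewrite !fctE; ring.
exact: sqr_ge0.
Qed.

End CoordinateAverage.

(** * Relative entropy *)

Section RelativeEntropy.
Context (R : realType).

(* Since [0 * ln _ = 0], only the support of [A] contributes. *)
Definition relative_entropy (S : finType) (A Q : S -> R) : R :=
  \sum_s A s * ln (A s / Q s).

Lemma ln_le_subr1 (x : R) : 0 < x -> ln x <= x - 1.
Proof. by move=> x_gt0; rewrite -{1}(subrKC 1 x) le_ln1Dx//; lra. Qed.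

Lemma sqr_sub_sqrt_le (a q : R) : 0 <= a -> 0 < q ->
  (Num.sqrt a - Num.sqrt q) ^+ 2 <= a * ln (a / q) - a + q.
Proof.
move=> a_ge0 q_gt0; have q_ge0 := ltW q_gt0.
have -> : (Num.sqrt a - Num.sqrt q) ^+ 2 = a - 2 * (Num.sqrt a * Num.sqrt q) + q.
  by rewrite sqrrB !sqr_sqrtr// mulr_natl.
have [->|a_neq0] := eqVneq a 0; first by rewrite sqrtr0 !mul0r; lra.
have a_gt0 : 0 < a by rewrite lt_def a_neq0.
set x := Num.sqrt a; set y := Num.sqrt q.
have [x_gt0 y_gt0] : 0 < x /\ 0 < y by rewrite !sqrtr_gt0.
have -> : a / q = (y / x) ^- 2.
  rewrite -[in LHS](sqr_sqrtr a_ge0) -[in LHS](sqr_sqrtr q_ge0).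
  by rewrite -expr_div_n -exprVn invf_div.
have : ln (y / x) <= y / x - 1 by rewrite ln_le_subr1// divr_gt0.
rewrite lnV ?posrE ?exprn_gt0 ?divr_gt0// lnXn ?divr_gt0//.
rewrite -(ler_pM2l a_gt0); have -> : a * (y / x - 1) = x * y - a.
  by rewrite -(sqr_sqrtr a_ge0) -/x; field; rewrite gt_eqF.
by rewrite mulrN -mulr_natr; lra.
Qed.

(* A weak form of Pinsker's inequality, through the Hellinger distance. *)
Lemma sqr_sum_dist_le_relative_entropy (S : finType) (A Q : S -> R) :
  (forall s, 0 <= A s) -> (forall s, 0 < Q s) -> \sum_s A s = 1 -> \sum_s Q s = 1 ->
  (\sum_s `|A s - Q s|) ^+ 2 <= 4 * relative_entropy A Q.
Proof.
move=> A_ge0 Q_gt0 A1 Q1; have Q_ge0 s := ltW (Q_gt0 s).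
pose x s := Num.sqrt (A s); pose y s := Num.sqrt (Q s).
have xE s : A s = x s ^+ 2 by rewrite sqr_sqrtr.
have yE s : Q s = y s ^+ 2 by rewrite sqr_sqrtr.
have distE s : `|A s - Q s| = `|x s - y s| * `|x s + y s|.
  by rewrite -normrM -subr_sqr -xE -yE.
have hellinger_le : \sum_s `|x s - y s| ^+ 2 <= relative_entropy A Q.
  have -> : relative_entropy A Q = \sum_s (A s * ln (A s / Q s) - A s + Q s).
    by rewrite !big_split /= sumrN A1 Q1 subrK.
  by apply: ler_sum => s _; rewrite real_normK ?num_real// sqr_sub_sqrt_le.
have sum_le4 : \sum_s `|x s + y s| ^+ 2 <= 4.
  have -> : 4 = \sum_s 2 * (A s + Q s) :> R by rewrite -mulr_sumr big_split /= A1 Q1; lra.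
  apply: ler_sum => s _; rewrite real_normK ?num_real// xE yE.
  by have := sqr_ge0 (x s - y s); rewrite sqrrB sqrrD; lra.
under eq_bigr do rewrite distE.
apply: (le_trans (sum_cauchy_schwarz _ _)); rewrite mulrC.
by apply: ler_pM => //; apply: sumr_ge0 => s _; exact: sqr_ge0.
Qed.

(* [B s t / A s] bounds the square of the conditional law, so the extra term is an upper
   bound for the average chi-square divergence of the conditional laws from [q]. *)
Lemma relative_entropy_chain_le (S T : finType) (a : S * T -> R) (B : S -> T -> R)
    (A Q : S -> R) (q : T -> R) :
  (forall st, 0 <= a st) -> (forall s, \sum_t a (s, t) = A s) ->
  (forall s, 0 < Q s) -> (forall t, 0 < q t) ->
  (forall s t, 0 <= B s t) -> (forall s t, a (s, t) ^+ 2 <= A s * B s t) ->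
  relative_entropy a (fun st => Q st.1 * q st.2) <=
  relative_entropy A Q + \sum_s \sum_t B s t / q t - \sum_s A s.
Proof.
move=> a_ge0 sum_a Q_gt0 q_gt0 B_ge0 aB.
have aA s t : a (s, t) <= A s.
  by rewrite -sum_a (bigD1 t)//= lerDl sumr_ge0.
have term_le s t : a (s, t) * ln (a (s, t) / (Q s * q t)) <=
    a (s, t) * ln (A s / Q s) + B s t / q t - a (s, t).
  have [->|a_neq0] := eqVneq (a (s, t)) 0.
    by rewrite !mul0r add0r subr0 divr_ge0// ltW.
  have a_gt0 : 0 < a (s, t) by rewrite lt_def a_neq0/=.
  have A_gt0 : 0 < A s := lt_le_trans a_gt0 (aA s t).
  have -> : a (s, t) / (Q s * q t) = (A s / Q s) * (a (s, t) / (A s * q t)).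
    by field; rewrite !gt_eqF.
  rewrite lnM ?posrE ?divr_gt0 ?mulr_gt0// mulrDr -addrA lerD2l.
  apply: (@le_trans _ _ (a (s, t) * (a (s, t) / (A s * q t) - 1))).
    by rewrite ler_wpM2l// ln_le_subr1// divr_gt0// mulr_gt0.
  rewrite mulrBr mulr1 lerD2r mulrA -expr2 invfM mulrA ler_pM2r ?invr_gt0//.
  by rewrite ler_pdivrMr// mulrC.
have -> : relative_entropy A Q + \sum_s \sum_t B s t / q t - \sum_s A s =
    \sum_s \sum_t (a (s, t) * ln (A s / Q s) + B s t / q t - a (s, t)).
  rewrite -big_split /= -sumrB; apply: eq_bigr => s _.
  by rewrite !big_split /= -mulr_suml sumrN sum_a.
rewrite /relative_entropy (pair_bigA _ (fun s t => _)) /=.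
by apply: ler_sum => -[s t] _; exact: term_le.
Qed.

End RelativeEntropy.

(** * Latent-position graphs *)

Section VertexCoordinates.
Context (R : realType) (dX : measure_display) (X : measurableType dX).
Variables (P : probability X R) (C : finType).
Local Notation Omega := (nat * C -> X).
Implicit Types (f g : Omega -> R) (z : Omega) (x y : C -> X) (u v k : nat) (V : {pred nat}).

Lemma avgs_enum_cst (F : (C -> X) -> R) x y : avgs P (enum C) F x = avgs P (enum C) F y.
Proof.
have /depends_onP : avgs P (enum C) F \in depends_on pred0.
  apply/depends_on_avgs/depends_onP => x' y' xy'; congr F; apply/funext => c.
  by apply: xy'; rewrite !inE mem_enum.
by apply.
Qed.

Definition coords v : seq (nat * C) := [seq (v, c) | c <- enum C].

Definition position v z : C -> X := fun c => z (v, c).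

Definition reposition v x z : Omega := fun i => if i.1 == v then x i.2 else z i.

Lemma position_repositionE v x z : position v (reposition v x z) = x.
Proof. by apply/funext => c; rewrite /position /reposition eqxx. Qed.

Lemma position_repositionN u v x z : u != v -> position u (reposition v x z) = position u z.
Proof. by move=> /negPf uv; apply/funext => c; rewrite /position /reposition uv. Qed.

Definition vavg v f := avgs P (coords v) f.

Lemma vavgE v f z :
  vavg v f z = avgs P (enum C) (fun x => f (reposition v x z)) (position v z).
Proof.
rewrite /vavg /coords; elim: (enum C) z => [|c s ih] z /=.
  congr f; apply/funext => -[w c]; rewrite /reposition /position /=.
  by case: eqP => // ->.
rewrite !avgE; apply: eq_Rintegral => t _; rewrite ih; congr (avgs P s _ _).
  apply/funext => x; congr f; apply/funext => -[w c']; rewrite /reposition /=.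
  by case: eqVneq => // wv; rewrite dfwithout//; apply: contraNneq wv => -[->].
apply/funext => c'; rewrite /position; have [->|cc'] := eqVneq c c'.
  by rewrite !dfwithin.
by rewrite !dfwithout//; apply: contraNneq cc' => -[->].
Qed.

Definition at_vertices V : {pred nat * C} := [pred i | i.1 \in V].

Lemma depends_on_vertices V f :
  (forall z z', {in V, forall v, position v z = position v z'} -> f z = f z') ->
  f \in depends_on (at_vertices V).
Proof.
move=> fV; apply/depends_onP => z z' zz'; apply: fV => v vV.
by apply/funext => c; apply: zz'.
Qed.

Lemma vavgM V v f g : f \in depends_on (at_vertices V) -> v \notin V -> g \in bmeasurable ->
  vavg v (f * g) = f * vavg v g.
Proof. by move=> fV vV mg; apply: (avgsM P fV) mg => i /mapP[c _ ->]. Qed.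

Lemma depends_on_vavg V v f :
  f \in depends_on (at_vertices [predU1 v & V]) -> vavg v f \in depends_on (at_vertices V).
Proof.
move=> fV; apply/depends_on_avgs; apply: depends_onS fV => -[w c]; rewrite !inE /=.
by move=> /predU1P[->|->//]; rewrite map_f ?orbT// mem_enum.
Qed.

Definition first_coords k : seq (nat * C) := flatten [seq coords v | v <- iota 0 k].

Definition expect k f := avgs P (first_coords k) f.

Lemma first_coordsS k : first_coords k.+1 = first_coords k ++ coords k.
Proof. by rewrite /first_coords -addn1 iotaD add0n map_cat flatten_cat /= cats0. Qed.

Lemma mem_first_coords k i : (i \in first_coords k) = (i.1 < k)%N.
Proof.
case: i => v c; apply/flatten_mapP/idP => /= [[w]|vk].
  by rewrite mem_iota add0n /= => wk /mapP[c' _ [-> _]].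
by exists v; rewrite ?mem_iota// map_f// mem_enum.
Qed.

Lemma first_coords_uniq k : uniq (first_coords k).
Proof.
elim: k => // k ih; rewrite first_coordsS cat_uniq ih map_inj_uniq => [|c c' []//].
rewrite enum_uniq andbT /=; apply/hasPn => _ /mapP[c _ ->].
by rewrite mem_first_coords ltnn.
Qed.

Lemma expectS k f : expect k.+1 f = expect k (vavg k f).
Proof. by rewrite /expect first_coordsS avgs_cat. Qed.

Lemma expect_prod k (V : nat -> {pred nat}) (F : nat -> Omega -> R) :
  (forall i, F i \in bmeasurable) -> (forall i, F i \in depends_on (at_vertices (V i))) ->
  (forall i j, (i < k)%N -> (j < k)%N -> i != j -> i \notin V j) ->
  expect k (\prod_(i < k) F i) = \prod_(i < k) vavg i (F i).
Proof.
move=> mF FV disj; rewrite -(big_mkord xpredT F) -(big_mkord xpredT (fun i => vavg i (F i))).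
rewrite /index_iota subn0; apply: avgs_prod mF FV _; first exact: iota_uniq.
move=> i j; rewrite !mem_iota !add0n => ik jk ij _ /mapP[c _ ->].
exact: disj.
Qed.

End VertexCoordinates.

Section Indicator.
Context (R : realType) (Omega : Type).

Definition eqind (S : eqType) (Y : Omega -> S) (a : S) : Omega -> R := fun z => (Y z == a)%:R.

Lemma sum_eqind (S : finType) (Y : Omega -> S) : \sum_a eqind Y a = 1.
Proof.
apply/funext => z; rewrite fct_sumE (bigD1 (Y z))//= /eqind eqxx big1 ?addr0// => a.
by rewrite eq_sym => /negPf ->.
Qed.

Lemma eqind_false (Y : Omega -> bool) : eqind Y false = 1 - eqind Y true.
Proof.
by apply/funext => z; rewrite !fctE /eqind eqb_id eqbF_neg; case: (Y z); rewrite ?subrr ?subr0.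
Qed.

Lemma eqind_pair (S T : eqType) (Y : Omega -> S) (Z : Omega -> T) a b :
  eqind (fun z => (Y z, Z z)) (a, b) = eqind Y a * eqind Z b.
Proof. by apply/funext => z; rewrite fctE /eqind xpair_eqE -mulnb natrM. Qed.

Lemma eqind_ffun (J : finType) (S : eqType) (Y : J -> Omega -> S) (r : {ffun J -> S}) :
  eqind (fun z => [ffun j => Y j z]) r = \prod_j eqind (Y j) (r j).
Proof.
apply/funext => z; rewrite fct_prodE /eqind; case: eqP => [<-|/eqP].
  by rewrite big1// => j _; rewrite ffunE eqxx.
move=> rY; have /existsP[j /negPf rj] : [exists j, Y j z != r j].
  rewrite -negb_forall; apply: contra rY => /forallP rY; apply/eqP/ffunP => j.
  by rewrite ffunE; exact/eqP.
by rewrite (bigD1 j)//= rj mul0r.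
Qed.

Lemma eqind_sqr (S : eqType) (Y : Omega -> S) a : eqind Y a ^+ 2 = eqind Y a.
Proof. by apply/funext => z; rewrite exprfctE /eqind -natrX; case: eqP. Qed.

Lemma eqind_ge0 (S : eqType) (Y : Omega -> S) a z : 0 <= eqind Y a z.
Proof. exact: ler0n. Qed.

Lemma eqind_le1 (S : eqType) (Y : Omega -> S) a z : eqind Y a z <= 1.
Proof. by rewrite /eqind lern1 leq_b1. Qed.

End Indicator.

Notation adj_row k := {ffun 'I_k -> bool}.

Section RowGraph.

(* A graph on [k.+1] vertices, stored row by row: a graph on the first [k] vertices and the
   adjacencies of the vertex [k] to them. *)
Fixpoint row_graph k : finType :=
  if k is k'.+1 then (row_graph k' * adj_row k')%type : finType else unit.

Fixpoint rows_of k (A : nat -> nat -> bool) : row_graph k :=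
  if k is k'.+1 then (rows_of k' A, [ffun i : 'I_k' => A i k']) else tt.

Lemma rows_ofP k A B : rows_of k A = rows_of k B <->
  forall i j, (i < j)%N -> (j < k)%N -> A i j = B i j.
Proof.
elim: k => [|k ih] //=; split=> [[/ih AB /ffunP rAB] i j ij|AB].
  rewrite ltnS leq_eqVlt => /predU1P[jk|jk]; last exact: AB.
  by subst j; have := rAB (Ordinal ij); rewrite !ffunE.
congr (_, _); first by apply/ih => i j ij jk; apply: AB => //; exact: leqW.
by apply/ffunP => i; rewrite !ffunE AB.
Qed.

Definition add_vertex k (G : row_graph k) (r : adj_row k) : row_graph k.+1 := (G, r).

Lemma sum_row_graphS (R : nmodType) k (F : row_graph k.+1 -> R) :
  \sum_(G : row_graph k.+1) F G = \sum_(G : row_graph k) \sum_r F (add_vertex G r).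
Proof. by rewrite pair_bigA; apply: eq_bigr => -[G r]. Qed.

End RowGraph.

Section ErdosRenyi.
Context (R : realType).
Variable p : R.

Definition row_prob k (r : adj_row k) : R := \prod_i bernoulli_pmf p (r i).

Fixpoint er_prob k : row_graph k -> R :=
  match k with
  | 0 => fun _ => 1
  | k'.+1 => fun G => er_prob G.1 * row_prob G.2
  end.

Lemma sum_row_prob k : \sum_(r : adj_row k) row_prob r = 1.
Proof.
rewrite /row_prob -(bigA_distr_bigA (fun _ => bernoulli_pmf p)) big1// => i _.
by rewrite big_bool /= addrC subrK.
Qed.

Lemma sum_er_prob k : \sum_(G : row_graph k) er_prob G = 1.
Proof.
elim: k => [|k ih]; first by rewrite /= (big_pred1 tt)// => -[].
rewrite sum_row_graphS /= -[RHS]ih; apply: eq_bigr => G _.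
by rewrite -mulr_sumr sum_row_prob mulr1.
Qed.

Lemma er_prob_rows_of k (A : nat -> nat -> bool) :
  er_prob (rows_of k A) = \prod_(j < k) \prod_(i < k | (i < j)%N) bernoulli_pmf p (A i j).
Proof.
transitivity (\prod_(j < k) \prod_(i < j) bernoulli_pmf p (A i j)); last first.
  apply: eq_bigr => j _.
  by rewrite (big_ord_widen _ (fun i => bernoulli_pmf p (A i j)) (ltnW (ltn_ord j))).
elim: k => [|k ih]; first by rewrite big_ord0.
rewrite big_ord_recr /= -ih; congr (_ * _).
by apply: eq_bigr => i _; rewrite ffunE.
Qed.

Hypothesis p_gt0 : 0 < p.
Hypothesis p_lt1 : p < 1.

Lemma bernoulli_pmf_gt0 e : 0 < bernoulli_pmf p e.
Proof. by case: e => //=; rewrite subr_gt0. Qed.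

Lemma row_prob_gt0 k (r : adj_row k) : 0 < row_prob r.
Proof. by apply: prodr_gt0 => i _; exact: bernoulli_pmf_gt0. Qed.

Lemma er_prob_gt0 k (G : row_graph k) : 0 < er_prob G.
Proof. by elim: k G => //= k ih G; rewrite mulr_gt0 ?row_prob_gt0. Qed.

End ErdosRenyi.

Section LatentPositionGraph.
Context (R : realType) (dX : measure_display) (X : measurableType dX).
Variables (P : probability X R) (C : finType) (link : (C -> X) -> (C -> X) -> bool) (p : R).
Hypothesis linkC : forall x y, link x y = link y x.
Hypothesis measurable_link : jointly_measurable_rel link.
Hypothesis link_marginal : forall x, avgs P (enum C) (fun y => (link x y)%:R) = cst p.

Local Notation Omega := (nat * C -> X).
Local Notation vavg := (@vavg R dX X P C).
Local Notation expect := (@expect R dX X P C).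
Local Notation eqind := (@eqind R Omega _).
Implicit Types (f g : Omega -> R) (z : Omega) (x y : C -> X) (u v w k : nat).

Definition adj u v z : bool := link (position u z) (position v z).

Lemma adjC u v : adj u v = adj v u.
Proof. by apply/funext => z; rewrite /adj linkC. Qed.

Lemma bmeasurable_adj u v e : eqind (adj u v) e \in bmeasurable.
Proof.
have adj_true : eqind (adj u v) true \in bmeasurable.
  apply/bmeasurableP; split; last by exists 1 => z; rewrite ger0_norm ?eqind_ge0 ?eqind_le1.
  move=> d T g mg; apply: measurable_bool_natr.
  rewrite (_ : (fun t => _) = fun t => link (fun c => g (u, c) t) (fun c => g (v, c) t)).
    exact: measurable_link.
  by apply/funext => t; rewrite eqb_id.
by case: e => //; rewrite eqind_false rpredB ?rpred1.
Qed.

Lemma depends_on_adj u v e : eqind (adj u v) e \in depends_on (at_vertices (pred2 u v)).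
Proof.
apply: depends_on_vertices => z z' zz'.
by rewrite /eqind /adj (zz' u) ?(zz' v) ?inE ?eqxx ?orbT.
Qed.

Lemma vavg_adj u v : u != v -> vavg v (eqind (adj u v) true) = cst p.
Proof.
move=> uv; apply/funext => z; rewrite vavgE.
rewrite -[RHS]/(cst p (position v z)) -(link_marginal (position u z)).
congr (avgs _ _ _ _); apply/funext => x.
by rewrite /eqind /adj position_repositionE position_repositionN// eqb_id.
Qed.

(* The base point [x] is immaterial, since all coordinates are averaged. *)
Definition codegree x y : R := avgs P (enum C) (fun t => (link t x)%:R * (link t y)%:R) x.

Definition correlation x y : R := (codegree x y - p ^+ 2) / (p * (1 - p)).

Definition vcorrelation u v : Omega -> R :=
  fun z => correlation (position u z) (position v z).

Lemma vavg_common_adj w u v : u != w -> v != w ->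
  vavg w (eqind (adj w u) true * eqind (adj w v) true) =
  fun z => codegree (position u z) (position v z).
Proof.
move=> uw vw; apply/funext => z; rewrite vavgE /codegree.
rewrite (avgs_enum_cst P _ _ (position u z)); congr (avgs _ _ _ _); apply/funext => x.
by rewrite mulrfctE /eqind /adj position_repositionE !position_repositionN// !eqb_id.
Qed.

Lemma bmeasurable_vcorrelation u v : vcorrelation u v \in bmeasurable.
Proof.
pose w := (maxn u v).+1.
have [uw vw] : u != w /\ v != w by rewrite !ltn_eqF ?ltnS ?leq_maxl ?leq_maxr.
have -> : vcorrelation u v =
    (vavg w (eqind (adj w u) true * eqind (adj w v) true) - cst (p ^+ 2)) *
    cst (p * (1 - p))^-1.
  by apply/funext => z; rewrite vavg_common_adj// !fctE.
by rewrite rpredM ?rpredB ?bmeasurable_avgs ?rpredM ?bmeasurable_adj// bmeasurable_cst.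
Qed.

Definition row k v z : adj_row k := [ffun i : 'I_k => adj i v z].

Lemma eqind_row k v (r : adj_row k) :
  eqind (row k v) r = \prod_(i < k) eqind (adj i v) (r i).
Proof. exact: eqind_ffun. Qed.

Lemma bmeasurable_row k v r : eqind (row k v) r \in bmeasurable.
Proof. by rewrite eqind_row rpred_prod// => i _; exact: bmeasurable_adj. Qed.

Lemma depends_on_row k v r : eqind (row k v) r \in depends_on (at_vertices [predU1 v & gtn k]).
Proof.
rewrite eqind_row; apply: rpred_prod => i _; apply: depends_onS (depends_on_adj i v (r i)).
by move=> [w c]; rewrite !inE /= => /orP[/eqP->|->//]; rewrite ltn_ord orbT.
Qed.

Definition row_cond_prob k (r : adj_row k) : Omega -> R := vavg k (eqind (row k k) r).

Lemma row_cond_probE k v (r : adj_row k) : (k <= v)%N ->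
  row_cond_prob r = vavg v (eqind (row k v) r).
Proof.
move=> kv; apply/funext => z; rewrite /row_cond_prob !vavgE.
rewrite (avgs_enum_cst P _ _ (position v z)).
congr (avgs _ _ _ _); apply/funext => x; rewrite /eqind; congr ((_ == _)%:R).
apply/ffunP => i; have ik := ltn_ord i.
by rewrite !ffunE /adj !position_repositionE !position_repositionN ?ltn_eqF// (leq_trans ik).
Qed.

Lemma bmeasurable_row_cond_prob k (r : adj_row k) : row_cond_prob r \in bmeasurable.
Proof. by rewrite bmeasurable_avgs ?bmeasurable_row. Qed.

Lemma depends_on_row_cond_prob k (r : adj_row k) :
  row_cond_prob r \in depends_on (at_vertices (gtn k)).
Proof. by apply: depends_on_vavg; exact: depends_on_row. Qed.

Lemma sum_row_cond_prob k : \sum_(r : adj_row k) row_cond_prob r = 1.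
Proof.
rewrite /row_cond_prob /vavg -avgs_sum => [|r]; last exact: bmeasurable_row.
by rewrite sum_eqind avgs_cst.
Qed.

Lemma row_cond_prob_sqr k (r : adj_row k) : row_cond_prob r ^+ 2 =
  vavg k (vavg k.+1 (eqind (row k k) r * eqind (row k k.+1) r)).
Proof.
rewrite (vavgM P (depends_on_row k r)) ?bmeasurable_row//; last first.
  by rewrite !inE gtn_eqF//= ltnNge leqnSn.
rewrite -row_cond_probE// mulrC (vavgM P (depends_on_row_cond_prob r)) ?bmeasurable_row//.
by rewrite inE /= ltnn.
Qed.

Hypothesis p_gt0 : 0 < p.
Hypothesis p_lt1 : p < 1.

(* The factor contributed by the vertex [w] to the second moment of the likelihood ratio of
   the rows of [u] and [v]. *)
Definition likelihood_factor w u v : Omega -> R :=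
  \sum_(e : bool) cst (bernoulli_pmf p e)^-1 * (eqind (adj w u) e * eqind (adj w v) e).

Lemma bmeasurable_likelihood_factor w u v : likelihood_factor w u v \in bmeasurable.
Proof.
by apply: rpred_sum => e _; rewrite !rpredM ?bmeasurable_adj// bmeasurable_cst.
Qed.

Lemma depends_on_likelihood_factor w u v :
  likelihood_factor w u v \in depends_on (at_vertices (pred3 w u v)).
Proof.
apply: rpred_sum => e _; rewrite !rpredM ?depends_on_cst//.
  by apply: depends_onS (depends_on_adj w u e) => i; rewrite !inE => /orP[]->; rewrite ?orbT.
by apply: depends_onS (depends_on_adj w v e) => i; rewrite !inE => /orP[]->; rewrite ?orbT.
Qed.

Lemma vavg_likelihood_factor w u v : u != w -> v != w ->
  vavg w (likelihood_factor w u v) = 1 + vcorrelation u v.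
Proof.
move=> uw vw; pose a := eqind (adj w u) true; pose b := eqind (adj w v) true.
have [ma mb] : a \in bmeasurable /\ b \in bmeasurable by rewrite !bmeasurable_adj.
have mcst (c : R) : cst c \in @bmeasurable R _ X (nat * C)%type := bmeasurable_cst _ _ c.
have -> : likelihood_factor w u v =
    cst (1 - p)^-1 * (1 - a - b) + cst (p^-1 + (1 - p)^-1) * (a * b).
  rewrite /likelihood_factor big_bool /= !eqind_false -/a -/b.
  by rewrite -[cst (_ + _)]/(cst p^-1 + cst (1 - p)^-1); ring.
rewrite /vavg avgsD ?avgsZ ?avgsB ?(mcst, rpredM, rpredB, rpred1)// -!/(vavg w _).
rewrite [vavg w 1](avgs_cst P _ 1).
rewrite vavg_common_adj// /a /b [adj w u]adjC [adj w v]adjC !vavg_adj//.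
apply/funext => z; rewrite /vcorrelation /correlation !(onerfctE, fctE).
by field; rewrite !gt_eqF// subr_gt0.
Qed.

Lemma sum_row_likelihood k :
  \sum_(r : adj_row k)
    cst (row_prob p r)^-1 * (eqind (row k k) r * eqind (row k k.+1) r) =
  \prod_(i < k) likelihood_factor i k k.+1.
Proof.
rewrite /likelihood_factor bigA_distr_bigA /=; apply: eq_bigr => r _.
rewrite !eqind_row -!big_split /=; apply/funext => z.
by rewrite mulrfctE !fct_prodE /row_prob -prodfV -big_split.
Qed.

(* The average over two independent copies of the new vertex [k]. *)
Definition likelihood_second_moment k : Omega -> R :=
  vavg k (vavg k.+1 ((1 + vcorrelation k k.+1) ^+ k)).

Lemma expect_row_cond_prob_sqr k :
  expect k (\sum_(r : adj_row k) cst (row_prob p r)^-1 * row_cond_prob r ^+ 2) =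
  likelihood_second_moment k.
Proof.
have mL i : likelihood_factor i k k.+1 \in bmeasurable.
  exact: bmeasurable_likelihood_factor.
have mrow2 (r : adj_row k) : eqind (row k k) r * eqind (row k k.+1) r \in bmeasurable.
  by rewrite rpredM ?bmeasurable_row.
have mcst (c : R) : cst c \in @bmeasurable R _ X (nat * C)%type := bmeasurable_cst _ _ c.
transitivity (expect k (vavg k (vavg k.+1 (\prod_(i < k) likelihood_factor i k k.+1)))).
  congr (expect k _); rewrite -sum_row_likelihood /vavg.
  rewrite -avgs_cat avgs_sum => [|r]; last by rewrite rpredM.
  by apply: eq_bigr => r _; rewrite avgsZ// avgs_cat row_cond_prob_sqr.
rewrite /likelihood_second_moment /expect /vavg avgsC ?bmeasurable_avgs ?rpred_prod//.
congr (avgs P (coords C k) _); rewrite avgsC ?rpred_prod//; congr (avgs P (coords C k.+1) _).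
rewrite -/(expect k _) (expect_prod P mL (fun i => depends_on_likelihood_factor i k k.+1)).
  rewrite (eq_bigr (fun=> 1 + vcorrelation k k.+1)) => [|i _].
    by rewrite prodr_const card_ord.
  by rewrite vavg_likelihood_factor// gtn_eqF// (ltn_trans (ltn_ord i)).
move=> i j ik jk ij; rewrite !inE !negb_or ij !ltn_eqF//.
exact: ltn_trans (ltnSn k).
Qed.

Definition sample_graph k z : row_graph k := rows_of k (fun i j => adj i j z).

Lemma eqind_sample_graphS k (G : row_graph k) (r : adj_row k) :
  eqind (sample_graph k.+1) (add_vertex G r) = eqind (sample_graph k) G * eqind (row k k) r.
Proof. exact: eqind_pair. Qed.

Lemma bmeasurable_sample_graph k G : eqind (sample_graph k) G \in bmeasurable.
Proof.
elim: k G => [|k ih] G.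
  by rewrite (_ : eqind _ _ = 1) ?rpred1//; apply/funext => z; case: G.
by case: G => G r; rewrite eqind_sample_graphS rpredM ?bmeasurable_row.
Qed.

Lemma depends_on_sample_graph k G :
  eqind (sample_graph k) G \in depends_on (at_vertices (gtn k)).
Proof.
apply: depends_on_vertices => z z' zz'; congr ((_ == _)%:R).
by apply/rows_ofP => i j ij jk; rewrite /adj !zz'//; exact: ltn_trans jk.
Qed.

Variable z0 : Omega.

Definition graph_prob k (G : row_graph k) : R := expect k (eqind (sample_graph k) G) z0.

Lemma graph_prob_ge0 k (G : row_graph k) : 0 <= graph_prob G.
Proof. by apply: avgs_ge0 => [|z]; [exact: bmeasurable_sample_graph|exact: eqind_ge0]. Qed.

Lemma sum_graph_prob k : \sum_(G : row_graph k) graph_prob G = 1.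
Proof.
have := avgs_sum P (first_coords C k) (index_enum (row_graph k))
  (@bmeasurable_sample_graph k).
by rewrite sum_eqind => /(congr1 (@^~ z0)); rewrite avgs_cst fct_sumE.
Qed.

Lemma graph_probS k (G : row_graph k) (r : adj_row k) :
  graph_prob (add_vertex G r) = expect k (eqind (sample_graph k) G * row_cond_prob r) z0.
Proof.
rewrite /graph_prob expectS eqind_sample_graphS.
by rewrite (vavgM P (depends_on_sample_graph G)) ?bmeasurable_row// inE /= ltnn.
Qed.

Lemma sum_graph_probS k (G : row_graph k) :
  \sum_r graph_prob (add_vertex G r) = graph_prob G.
Proof.
under eq_bigr do rewrite graph_probS.
rewrite /graph_prob /expect -[in RHS](mulr1 (eqind _ G)) -(sum_row_cond_prob k) mulr_sumr.
rewrite avgs_sum ?fct_sumE// => r.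
by rewrite rpredM ?bmeasurable_sample_graph ?bmeasurable_row_cond_prob.
Qed.

Definition row_second_moment k (G : row_graph k) (r : adj_row k) : R :=
  expect k (eqind (sample_graph k) G * row_cond_prob r ^+ 2) z0.

Let bmeasurable_row_second_moment k (G : row_graph k) (r : adj_row k) :
  eqind (sample_graph k) G * row_cond_prob r ^+ 2 \in bmeasurable.
Proof.
by rewrite rpredM ?rpredX ?bmeasurable_sample_graph ?bmeasurable_row_cond_prob.
Qed.

Lemma row_second_moment_ge0 k (G : row_graph k) (r : adj_row k) : 0 <= row_second_moment G r.
Proof.
apply: avgs_ge0 => // z.
by rewrite mulr_ge0 ?eqind_ge0// exprfctE sqr_ge0.
Qed.

Lemma graph_prob_sqr_le k (G : row_graph k) (r : adj_row k) :
  graph_prob (add_vertex G r) ^+ 2 <= graph_prob G * row_second_moment G r.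
Proof.
have mG := bmeasurable_sample_graph G; have mr := bmeasurable_row_cond_prob r.
have := avgs_cauchy_schwarz P (first_coords C k) z0 mG (rpredM mG mr).
by rewrite mulrA -expr2 exprMn !eqind_sqr graph_probS.
Qed.

Lemma sum_row_second_moment k :
  \sum_(G : row_graph k) \sum_r row_second_moment G r / row_prob p r =
  likelihood_second_moment k z0.
Proof.
rewrite -expect_row_cond_prob_sqr exchange_big /expect avgs_sum => [|r]; last first.
  by rewrite rpredM ?rpredX ?bmeasurable_row_cond_prob// bmeasurable_cst.
rewrite fct_sumE; apply: eq_bigr => r _; rewrite avgsZ ?rpredX ?bmeasurable_row_cond_prob//.
rewrite -mulr_suml mulrC mulrfctE; congr (_ * _); rewrite /row_second_moment /expect.
have := avgs_sum P (first_coords C k) (index_enum (row_graph k))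
  (fun G => bmeasurable_row_second_moment G r).
by rewrite -mulr_suml sum_eqind mul1r fct_sumE => ->.
Qed.

Definition graph_entropy k : R := relative_entropy (@graph_prob k) (@er_prob R p k).

Lemma graph_entropyS k : graph_entropy k.+1 <=
  graph_entropy k + (likelihood_second_moment k z0 - 1).
Proof.
rewrite -(sum_graph_prob k) addrA -sum_row_second_moment.
apply: relative_entropy_chain_le.
- by move=> G; exact: graph_prob_ge0.
- exact: sum_graph_probS.
- by move=> G; exact: er_prob_gt0.
- by move=> r; exact: row_prob_gt0.
- exact: row_second_moment_ge0.
- exact: graph_prob_sqr_le.
Qed.

Lemma likelihood_second_moment_le k (delta : R) :
  (forall x, avgs P (enum C) (fun y => (1 + correlation x y) ^+ k) x <= 1 + delta) ->
  likelihood_second_moment k z0 <= 1 + delta.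
Proof.
move=> corr_le; apply: avgs_le_cst => [|z].
  by rewrite bmeasurable_avgs// rpredX// rpredD ?rpred1// bmeasurable_vcorrelation.
rewrite -/(vavg k.+1 _) vavgE (avgs_enum_cst P _ _ (position k z)).
rewrite (_ : (fun x => _) = fun y => (1 + correlation (position k z) y) ^+ k) ?corr_le//.
apply/funext => y; rewrite exprfctE addrfctE /vcorrelation.
by rewrite position_repositionE position_repositionN// ltn_eqF.
Qed.

Lemma graph_entropy_le n (delta : R) :
  (forall k x, (k < n)%N ->
    avgs P (enum C) (fun y => (1 + correlation x y) ^+ k) x <= 1 + delta) ->
  graph_entropy n <= n%:R * delta.
Proof.
elim: n => [_|n ih corr_le].
  rewrite mul0r /graph_entropy /relative_entropy (big_pred1 tt) => [|[]//].
  by rewrite (_ : graph_prob _ = 1) ?divr1 ?ln1 ?mulr0.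
rewrite -natr1 mulrDl mul1r; apply: le_trans (graph_entropyS n) _; apply: lerD.
  by apply: ih => k x kn; apply: corr_le; exact: leqW.
by rewrite lerBlDl; apply: likelihood_second_moment_le => x; exact: corr_le.
Qed.

End LatentPositionGraph.

(** * Second-order expansion *)

Section ElementaryInequalities.
Context (R : realType).
Implicit Types (x u M : R).

Lemma expn1D_le_quadratic u M k : -1 <= u -> 1 <= M -> 1 + u <= M ->
  (1 + u) ^+ k <= 1 + k%:R * u + k%:R ^+ 2 * u ^+ 2 * M ^+ k.
Proof.
move=> u_ge M_ge uM; elim: k => [|k ih]; first by rewrite expr0 expr0n /= !mul0r !addr0.
rewrite exprS; apply: le_trans (ler_wpM2l _ ih) _; first by lra.
rewrite [M ^+ k.+1]exprS -natr1; set K : R := k%:R; set N := M ^+ k.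
have K_ge0 : 0 <= K := ler0n _ _.
have N_ge1 : 1 <= N by rewrite exprn_ege1.
have N_ge0 : 0 <= N by lra.
have u2_ge0 : 0 <= u ^+ 2 := sqr_ge0 u.
have MN_ge1 : 1 <= M * N by rewrite mulr_ege1.
have quadratic_step : K ^+ 2 * u ^+ 2 * N * (1 + u) <= K ^+ 2 * u ^+ 2 * N * M.
  by rewrite ler_wpM2l// mulr_ge0// mulr_ge0// sqr_ge0.
have cross_term : K * u ^+ 2 * 1 <= K * u ^+ 2 * (M * N).
  by rewrite ler_wpM2l// mulr_ge0.
have rest_ge0 : 0 <= (K + 1) * u ^+ 2 * (M * N).
  by apply: mulr_ge0; [apply: mulr_ge0 => //; lra|lra].
by lra.
Qed.

Lemma expRB1_le x : expR x - 1 <= x * expR x.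
Proof.
have := ler_wpM2r (expR_ge0 x) (expR_ge1Dx (- x)).
by rewrite expRN mulVf ?expR_eq0//; lra.
Qed.

Lemma expR_ge1 x : 0 <= x -> 1 <= expR x.
Proof. by move=> x_ge0; rewrite -[leLHS]expR0 ler_expR. Qed.

Lemma expR_le_1D2x x : 0 <= x <= 2^-1 -> expR x <= 1 + 2 * x.
Proof. by move=> /andP[x_ge0 x_le]; have := expRB1_le x; have := expR_gt0 x; nra. Qed.

Lemma expr1D_le_expR x n : -1 <= x -> (1 + x) ^+ n <= expR (n%:R * x).
Proof.
move=> x_ge; have x1_ge0 : 0 <= 1 + x by lra.
by rewrite expRM_natl lerXn2r ?nnegrE ?expR_ge0 ?expR_ge1Dx.
Qed.

Lemma bernoulli_ineq x n : 0 <= x <= 1 -> 1 - n%:R * x <= (1 - x) ^+ n.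
Proof.
move=> /andP[x_ge0 x_le1]; elim: n => [|n ih]; first by rewrite mul0r subr0 expr0.
rewrite exprS; apply: le_trans (ler_wpM2l _ ih); last by rewrite subr_ge0.
by rewrite -natr1; have : 0 <= n%:R :> R := ler0n _ _; nra.
Qed.

End ElementaryInequalities.

Section PerturbedProduct.
Context (R : realType).
Variables (C : finType) (m : C -> R) (lam eta : R).
Hypothesis lam_range : 0 <= lam <= 2^-1.
Hypothesis m_range : forall c, 0 <= m c <= lam.
Hypothesis eta_range : 0 < eta <= 1.
Hypothesis lam_sqr_le : #|C|%:R * lam ^+ 2 <= eta.

Let total : R := \sum_c m c.

Let total_ge0 : 0 <= total.
Proof. by apply: sumr_ge0 => c _; case/andP: (m_range c). Qed.

Definition perturbed_factor c : R := 1 + (m c - lam ^+ 2) / (1 - lam) ^+ 2.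

Definition perturbed_prod : R := \prod_c perturbed_factor c.

Let tau2_ge : 1 <= 4 * (1 - lam) ^+ 2.
Proof. by case/andP: lam_range; nra. Qed.

Let tau2_gt0 : 0 < (1 - lam) ^+ 2.
Proof. by have := tau2_ge; lra. Qed.

Let lam_sqr_range : 0 <= 4 * lam ^+ 2 <= 1.
Proof.
case/andP: lam_range => lam_ge0 lam_le; rewrite mulr_ge0 ?sqr_ge0//=.
have := ler_pM lam_ge0 lam_ge0 lam_le lam_le; lra.
Qed.

Lemma prod_perturbed : \prod_c (1 - 2 * lam + m c) =
  ((1 - lam) ^+ #|C|) ^+ 2 * perturbed_prod.
Proof.
rewrite exprAC -prodr_const -big_split /=; apply: eq_bigr => c _.
by rewrite /perturbed_factor; field; rewrite gt_eqF//; case/andP: lam_range; lra.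
Qed.

Lemma perturbed_factor_ge c : 1 - 4 * lam ^+ 2 <= perturbed_factor c.
Proof.
case/andP: (m_range c) => m_ge0 _; rewrite lerD2l ler_pdivlMr//.
by have := ler_wpM2l (sqr_ge0 lam) tau2_ge; lra.
Qed.

Lemma perturbed_factor_le c : perturbed_factor c <= expR (4 * m c).
Proof.
case/andP: (m_range c) => m_ge0 _; apply: le_trans (expR_ge1Dx _).
rewrite lerD2l ler_pdivrMr//.
by have := ler_wpM2l m_ge0 tau2_ge; have := sqr_ge0 lam; lra.
Qed.

Lemma perturbed_factor_ge0 c : 0 <= perturbed_factor c.
Proof.
by apply: le_trans (perturbed_factor_ge c); case/andP: lam_sqr_range; lra.
Qed.

Lemma perturbed_prod_ge0 : 0 <= perturbed_prod.
Proof. by apply: prodr_ge0 => c _; exact: perturbed_factor_ge0. Qed.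

Lemma perturbed_prod_le_expR : perturbed_prod <= expR (4 * total).
Proof.
rewrite mulr_sumr expR_sum; apply: ler_prod => c _.
by rewrite perturbed_factor_ge0 perturbed_factor_le.
Qed.

Lemma perturbed_prod_ge : 1 - 4 * eta <= perturbed_prod.
Proof.
apply: (@le_trans _ _ ((1 - 4 * lam ^+ 2) ^+ #|C|)).
  apply: (@le_trans _ _ (1 - #|C|%:R * (4 * lam ^+ 2))).
    by rewrite lerD2l lerN2 mulrCA ler_pM2l.
  exact: bernoulli_ineq.
rewrite -prodr_const; apply: ler_prod => c _; rewrite perturbed_factor_ge andbT.
by case/andP: lam_sqr_range; lra.
Qed.

Lemma expR_total_le : expR (4 * total) <= expR (4 * (total / eta)).
Proof.
case/andP: eta_range => eta_gt0 eta_le1.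
by rewrite ler_expR ler_pM2l// ler_pdivlMr// ler_piMr.
Qed.

Lemma dist_perturbed_prod_le :
  `|perturbed_prod - 1| <= 4 * eta * expR (5 * (total / eta)).
Proof.
case/andP: eta_range => eta_gt0 eta_le1.
rewrite ler_norml; apply/andP; split.
  have := perturbed_prod_ge.
  have weight_ge1 : 1 <= expR (5 * (total / eta)).
    by rewrite expR_ge1// mulr_ge0// divr_ge0// ltW.
  have := ler_peMr (ltW eta_gt0) weight_ge1; lra.
apply: (@le_trans _ _ (4 * total * expR (4 * total))).
  by apply: le_trans (expRB1_le _); rewrite lerB// perturbed_prod_le_expR.
rewrite (_ : 5 * _ = total / eta + 4 * (total / eta)); last by ring.
rewrite expRD mulrA; apply: ler_pM; rewrite ?mulr_ge0 ?expR_ge0 ?expR_total_le//.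
rewrite -mulrA ler_pM2l// -ler_pdivrMl// mulrC.
by apply: le_trans (expR_ge1Dx _); rewrite lerDr.
Qed.

Lemma expR_total_le_prod : 28 * lam <= eta ->
  expR (14 * (total / eta)) <= \prod_c (1 + 28 / eta * m c).
Proof.
move=> lam_le; case/andP: eta_range => eta_gt0 _.
rewrite mulr_suml mulr_sumr expR_sum; apply: ler_prod => c _; rewrite expR_ge0 /=.
case/andP: (m_range c) => m_ge0 m_le.
rewrite (_ : 28 / eta * m c = 2 * (14 * (m c / eta))); last by ring.
apply: expR_le_1D2x; rewrite mulr_ge0 ?divr_ge0 ?(ltW eta_gt0)//=.
by rewrite mulrA ler_pdivrMr//; lra.
Qed.

Variable p : R.
Hypothesis p_def : (1 - lam) ^+ #|C| = p.
Hypothesis p_range : 0 < p <= 2^-1.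

Definition normalized_prod : R :=
  (\prod_c (1 - 2 * lam + m c) - p ^+ 2) / (p * (1 - p)).

Let odds_bounds : [/\ 0 <= p / (1 - p), p / (1 - p) <= 1 & p / (1 - p) <= 2 * p].
Proof.
case/andP: p_range => p_gt0 p_le; have q_gt0 : 0 < 1 - p by lra.
by split; [rewrite divr_ge0 ?ltW|rewrite ler_pdivrMr//; lra|rewrite ler_pdivrMr//; nra].
Qed.

Let normalized_prodE : normalized_prod = p / (1 - p) * (perturbed_prod - 1).
Proof.
rewrite /normalized_prod prod_perturbed p_def; field.
by rewrite !gt_eqF//; case/andP: p_range; lra.
Qed.

Lemma normalized_prod_ge : -1 <= normalized_prod.
Proof.
rewrite normalized_prodE; have [odds_ge0 odds_le _] := odds_bounds.
by have := perturbed_prod_ge0; nra.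
Qed.

Lemma normalized_prod_le : 1 + normalized_prod <= expR (4 * total).
Proof.
rewrite normalized_prodE; have [odds_ge0 odds_le _] := odds_bounds.
have weight_ge1 : 1 <= expR (4 * total) by rewrite expR_ge1// mulr_ge0.
by have := perturbed_prod_le_expR; nra.
Qed.

Lemma normalized_prod_sqr_le :
  normalized_prod ^+ 2 <= 64 * p ^+ 2 * eta ^+ 2 * expR (10 * (total / eta)).
Proof.
have [odds_ge0 _ odds_le] := odds_bounds.
case/andP: eta_range => eta_gt0 _; case/andP: p_range => p_gt0 _.
have -> : 64 * p ^+ 2 * eta ^+ 2 * expR (10 * (total / eta)) =
    (2 * p * (4 * eta * expR (5 * (total / eta)))) ^+ 2.
  by rewrite (_ : 10 * _ = 5 * (total / eta) + 5 * (total / eta)); [rewrite expRD; ring|ring].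
rewrite -[leLHS]real_normK ?num_real// lerXn2r// ?nnegrE//.
  by rewrite !mulr_ge0 ?expR_ge0// ltW.
by rewrite normalized_prodE normrM (ger0_norm odds_ge0) ler_pM ?dist_perturbed_prod_le.
Qed.

Lemma exp1D_normalized_prod_le k : k%:R * eta <= 1 -> 28 * lam <= eta ->
  (1 + normalized_prod) ^+ k <= 1 + k%:R * normalized_prod +
    64 * (k%:R * p * eta) ^+ 2 * \prod_c (1 + 28 / eta * m c).
Proof.
move=> k_le lam_le; case/andP: eta_range => eta_gt0 _.
have weight_ge1 : 1 <= expR (4 * total) by rewrite expR_ge1// mulr_ge0.
have expn_le : expR (4 * total) ^+ k <= expR (4 * (total / eta)).
  rewrite -expRM_natl ler_expR mulrCA ler_pM2l// ler_pdivlMr// mulrAC.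
  by rewrite ler_piMl.
apply: (le_trans (expn1D_le_quadratic k normalized_prod_ge weight_ge1 normalized_prod_le)).
rewrite lerD2l; apply: le_trans (ler_wpM2l _ (expR_total_le_prod lam_le)); last first.
  by rewrite mulr_ge0 ?sqr_ge0.
have -> : 64 * (k%:R * p * eta) ^+ 2 * expR (14 * (total / eta)) =
    k%:R ^+ 2 * (64 * p ^+ 2 * eta ^+ 2 * expR (10 * (total / eta))) *
    expR (4 * (total / eta)).
  rewrite (_ : 14 * _ = 10 * (total / eta) + 4 * (total / eta)); last by ring.
  by rewrite expRD; ring.
apply: ler_pM => //.
- by rewrite mulr_ge0 ?sqr_ge0.
- by rewrite ler_wpM2l ?sqr_ge0// normalized_prod_sqr_le.
Qed.

End PerturbedProduct.

(** * Coordinatewise graphs *)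

Section ProductFunctions.
Context (R : realType) (dX : measure_display) (X : measurableType dX).
Variables (P : probability X R) (C : finType).

Lemma bmeasurable_coord (phi : X -> R) (c : C) : measurable_fun setT phi ->
  (exists M, forall t, `|phi t| <= M) -> (fun x : C -> X => phi (x c)) \in bmeasurable.
Proof.
move=> mphi [M phiM]; apply/bmeasurableP; split; last by exists M.
by move=> d T g mg; exact: measurableT_comp.
Qed.

Lemma avgs_prod_coord (phi : C -> X -> R) : (forall c, measurable_fun setT (phi c)) ->
  (forall c, exists M, forall t, `|phi c t| <= M) ->
  avgs P (enum C) (fun x => \prod_c phi c (x c)) = cst (\prod_c \int[P]_t phi c t).
Proof.
move=> mphi bphi; pose F c (x : C -> X) := phi c (x c).
have mF c : F c \in bmeasurable by exact: bmeasurable_coord.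
have depF c : F c \in depends_on (pred1 c).
  by apply/depends_onP => x x' xx'; rewrite /F xx' ?inE.
have -> : (fun x => \prod_c phi c (x c)) = \prod_(c <- enum C) F c.
  by apply/funext => x; rewrite fct_prodE big_enum.
have {1}-> : enum C = flatten [seq [:: c] | c <- enum C] by elim: (enum C) => //= c s {1}->.
rewrite (avgs_prod P (enum_uniq C) mF depF) => [|c c' _ _ cc' i]; last first.
  by rewrite !inE => /eqP->.
apply/funext => x; rewrite fct_prodE big_enum; apply: eq_bigr => c _.
by rewrite /= avgE; apply: eq_Rintegral => t _; rewrite /F dfwithin.
Qed.

End ProductFunctions.

Section Overlap.
Context (R : realType) (dX : measure_display) (X : measurableType dX).
Variables (P : probability X R) (nbr : X -> X -> bool) (tau : R).
Hypothesis nbrC : forall s t, nbr s t = nbr t s.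
Hypothesis measurable_nbr : measurable_rel nbr.
Hypothesis nbr_marginal : forall s, \int[P]_t ((nbr s t)%:R : R) = tau.

Local Notation lam := (1 - tau).

Definition overlap (s t : X) : R := \int[P]_u ((1 - (nbr u s)%:R) * (1 - (nbr u t)%:R)).

(* A pair of points is encoded as a function on [bool], so that iterated averages apply:
   [true] is the point integrated out in [overlap]. *)
Let near (s : X) (z : bool -> X) : R := (nbr (z true) s)%:R.
Let close (z : bool -> X) : R := (nbr (z true) (z false))%:R.
Let far s := 1 - near s.
Let apart := 1 - close.

Let bmeasurable_near s : near s \in bmeasurable.
Proof.
apply/bmeasurableP; split; last by exists 1 => z; rewrite normr_nat lern1 leq_b1.
by move=> d T g mg; apply: measurable_bool_natr; exact: measurable_nbr.
Qed.

Let bmeasurable_close : close \in bmeasurable.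
Proof.
apply/bmeasurableP; split; last by exists 1 => z; rewrite normr_nat lern1 leq_b1.
by move=> d T g mg; apply: measurable_bool_natr; exact: measurable_nbr.
Qed.

Let bmeasurable_far s : far s \in bmeasurable.
Proof. by rewrite rpredB ?rpred1. Qed.

Let bmeasurable_apart : apart \in bmeasurable.
Proof. by rewrite rpredB ?rpred1. Qed.

Let avg_far s : avgs P [:: true] (far s) = cst lam.
Proof.
rewrite /far avgsB ?rpred1// [avgs P _ 1](avgs_cst P _ 1); apply/funext => z.
rewrite !fctE /= avgE -(nbr_marginal s); congr (1 - _); apply: eq_Rintegral => t _.
by rewrite /near dfwithin nbrC.
Qed.

Let avg_apart e : avgs P [:: e] apart = cst lam.
Proof.
rewrite /apart avgsB ?rpred1// [avgs P _ 1](avgs_cst P _ 1); apply/funext => z.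
rewrite !fctE /= avgE -(nbr_marginal (z (~~ e))); congr (1 - _); apply: eq_Rintegral => t _.
by rewrite /close; case: e; rewrite dfwithin dfwithout// nbrC.
Qed.

Let avg_far_apart s :
  avgs P [:: true] (far s * apart) = fun z => overlap s (z false).
Proof.
apply/funext => z; rewrite /= avgE; apply: eq_Rintegral => t _.
by rewrite mulrfctE /far /apart !addrfctE !opprfctE /near /close dfwithin dfwithout.
Qed.

Lemma overlap_range s t : 0 <= overlap s t <= lam.
Proof.
have far_ge0 z : 0 <= far s z by rewrite subr_ge0 /near lern1 leq_b1.
have apart_range z : 0 <= apart z <= 1.
  by rewrite subr_ge0 gerBl /close lern1 leq_b1 ler0n.
have -> : overlap s t = avgs P [:: true] (far s * apart) (fun=> t).
  by rewrite avg_far_apart.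
have -> : lam = avgs P [:: true] (far s) (fun=> t) by rewrite avg_far.
apply/andP; split.
  apply: avgs_ge0 => [|z]; first by rewrite rpredM.
  by rewrite mulrfctE mulr_ge0//; case/andP: (apart_range z).
by apply: avgs_le => [||z]; rewrite ?rpredM// mulrfctE ler_piMr//; case/andP: (apart_range z).
Qed.

Lemma measurable_overlap s : measurable_fun setT (overlap s).
Proof.
have /bmeasurableP[mo _] : avgs P [:: true] (far s * apart) \in bmeasurable.
  by rewrite bmeasurable_avgs// rpredM.
move: mo; rewrite avg_far_apart => /(_ _ X (fun=> id)); apply=> e.
exact: measurable_id.
Qed.

Lemma Rintegral_overlap s : \int[P]_t overlap s t = lam ^+ 2.
Proof.
have far_dep : far s \in depends_on (pred1 true).
  apply/depends_onP => z z' zz'; congr (1 - _).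
  by rewrite /near zz' ?inE.
have [mfar mapart] := (bmeasurable_far s, bmeasurable_apart).
have -> : \int[P]_t overlap s t =
    avgs P [:: false] (avgs P [:: true] (far s * apart)) (fun=> s).
  by rewrite avg_far_apart /= avgE; apply: eq_Rintegral => t _; rewrite dfwithin.
rewrite avgsC ?rpredM// (avgsM P far_dep)// => [|i]; last by rewrite !inE => /eqP->.
by rewrite avg_apart mulrC avgsZ// avg_far fctE.
Qed.

Lemma Rintegral_affine_overlap (al be : R) s :
  \int[P]_t (al + be * overlap s t) = al + be * lam ^+ 2.
Proof.
have integrable_overlap : P.-integrable setT (EFin \o overlap s).
  apply: measurable_bounded_integrable => //.
  - by rewrite (le_lt_trans (probability_le1 _ _))// ltry.
  - exact: measurable_overlap.
  - exists lam; split=> [|M lamM t _]; first exact: num_real.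
    by have /andP[? ?] := overlap_range s t; rewrite /= ger0_norm//; lra.
rewrite RintegralD//; last 2 first.
- by apply: finite_measure_integrable_cst.
- exact: (integrableZl measurableT be integrable_overlap).
rewrite Rintegral_cst// [X in fine X]probability_setT mulr1.
by rewrite RintegralZl// Rintegral_overlap.
Qed.

Lemma Rintegral_common_nbr s t :
  \int[P]_u ((nbr u s)%:R * (nbr u t)%:R) = 1 - 2 * lam + overlap s t.
Proof.
have [mfar mapart] := (bmeasurable_far s, bmeasurable_apart).
have -> : \int[P]_u ((nbr u s)%:R * (nbr u t)%:R) =
    avgs P [:: true] (near s * close) (fun=> t).
  rewrite /= avgE; apply: eq_Rintegral => u _.
  by rewrite mulrfctE /near /close dfwithin dfwithout.
have -> : near s * close = 1 - far s - apart + far s * apart by rewrite /far /apart; ring.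
rewrite avgsD ?(rpredB, rpredM, rpred1)// avgsB ?(rpredB, rpred1)// avgsB ?rpred1//.
rewrite avg_far avg_apart avg_far_apart.
by rewrite [avgs P _ 1](avgs_cst P _ 1) !fctE; ring.
Qed.

End Overlap.

Section CoordinatewiseGraph.
Context (R : realType) (dX : measure_display) (X : measurableType dX).
Variables (P : probability X R) (nbr : X -> X -> bool) (tau : R) (C : finType).
Hypothesis nbrC : forall s t, nbr s t = nbr t s.
Hypothesis measurable_nbr : measurable_rel nbr.
Hypothesis nbr_marginal : forall s, \int[P]_t ((nbr s t)%:R : R) = tau.

Local Notation lam := (1 - tau).
Local Notation p := (tau ^+ #|C|).
Implicit Types (x y : C -> X).

Definition coordwise x y : bool := [forall c, nbr (x c) (y c)].

Lemma coordwiseC x y : coordwise x y = coordwise y x.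
Proof. by apply: eq_forallb => c; rewrite nbrC. Qed.

Lemma coordwiseE x y : (coordwise x y)%:R = \prod_c (nbr (x c) (y c))%:R :> R.
Proof.
rewrite /coordwise; case: forallP => [xy|/forallP].
  by rewrite big1// => c _; rewrite xy.
by rewrite negb_forall => /existsP[c /negPf xy]; rewrite (bigD1 c)//= xy mul0r.
Qed.

Lemma measurable_coordwise : jointly_measurable_rel coordwise.
Proof.
move=> d T f g mf mg; rewrite (_ : (fun t => _) =
    fun t => all (fun c => nbr (f c t) (g c t)) (enum C)); last first.
  apply/funext => t; apply/forallP/allP => [fg c _|fg c]; first exact: fg.
  by apply: fg; rewrite mem_enum.
elim: (enum C) => [|c s ih]; first exact: measurable_cst.
by apply: measurable_and => //; exact: measurable_nbr.
Qed.

Let bounded_nbr (s : X) : exists M : R, forall t, `|(nbr s t)%:R : R| <= M.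
Proof. by exists 1 => t; rewrite normr_nat lern1 leq_b1. Qed.

Lemma coordwise_marginal x : avgs P (enum C) (fun y => (coordwise x y)%:R) = cst p.
Proof.
rewrite (_ : (fun y => _) = fun y => \prod_c (nbr (x c) (y c))%:R); last first.
  by apply/funext => y; rewrite coordwiseE.
rewrite (avgs_prod_coord P (phi := fun c t => (nbr (x c) t)%:R)) => [|c|c].
- by rewrite (eq_bigr (fun=> tau)) ?prodr_const// => c _; exact: nbr_marginal.
- by apply/measurable_bool_natr/measurable_nbr => //; exact: measurable_cst.
- exact: bounded_nbr.
Qed.

Lemma codegree_coordwise x y :
  codegree P coordwise x y = \prod_c (1 - 2 * lam + overlap P nbr (x c) (y c)).
Proof.
rewrite /codegree (_ : (fun t => _) =
    fun t => \prod_c ((nbr (t c) (x c))%:R * (nbr (t c) (y c))%:R)); last first.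
  by apply/funext => t; rewrite !coordwiseE big_split.
rewrite (avgs_prod_coord P (phi := fun c t => (nbr t (x c))%:R * (nbr t (y c))%:R)) => [|c|c].
- by apply: eq_bigr => c _; exact: Rintegral_common_nbr.
- by apply: measurable_funM; apply/measurable_bool_natr/measurable_nbr => //;
    exact: measurable_cst.
- by exists 1 => t; rewrite -natrM mulnb normr_nat lern1 leq_b1.
Qed.

Lemma correlation_coordwise x y : correlation P coordwise p x y =
  normalized_prod (fun c => overlap P nbr (x c) (y c)) lam p.
Proof. by rewrite /correlation codegree_coordwise. Qed.

Definition affine_overlap_prod (al be : R) x : (C -> X) -> R :=
  \prod_c (cst al + cst be * (fun y => overlap P nbr (x c) (y c))).

Lemma affine_overlap_prodE al be x y :
  affine_overlap_prod al be x y = \prod_c (al + be * overlap P nbr (x c) (y c)).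
Proof. by rewrite /affine_overlap_prod fct_prodE. Qed.

Lemma bmeasurable_affine_overlap_prod al be x : affine_overlap_prod al be x \in bmeasurable.
Proof.
apply: rpred_prod => c _; rewrite rpredD ?rpredM ?bmeasurable_cst//.
apply: bmeasurable_coord; first exact: measurable_overlap.
exists lam => t; have /andP[overlap_ge0 overlap_le] :=
  overlap_range nbrC measurable_nbr nbr_marginal (x c) t.
by rewrite ger0_norm.
Qed.

Lemma avgs_affine_overlap_prod al be x :
  avgs P (enum C) (affine_overlap_prod al be x) = cst ((al + be * lam ^+ 2) ^+ #|C|).
Proof.
rewrite (_ : affine_overlap_prod al be x =
    fun y => \prod_c (al + be * overlap P nbr (x c) (y c))); last first.
  by apply/funext => y; rewrite affine_overlap_prodE.
rewrite (avgs_prod_coord P (phi := fun c t => al + be * overlap P nbr (x c) t)) => [|c|c].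
- rewrite (eq_bigr (fun=> al + be * lam ^+ 2)) ?prodr_const// => c _.
  exact: Rintegral_affine_overlap.
- apply: (@measurable_funD _ _ _ _ (cst al)) => //.
  by apply: (@measurable_funM _ _ _ _ (cst be)) => //; exact: measurable_overlap.
- exists (`|al| + `|be| * lam) => t.
  have /andP[overlap_ge0 overlap_le] := overlap_range nbrC measurable_nbr nbr_marginal (x c) t.
  by rewrite (le_trans (ler_normD _ _))// lerD2l normrM ler_wpM2l// ger0_norm.
Qed.

Lemma correlation_affine_overlap_prod x : correlation P coordwise p x =
  cst (p * (1 - p))^-1 * (affine_overlap_prod (1 - 2 * lam) 1 x - cst (p ^+ 2)).
Proof.
apply/funext => y; rewrite /correlation codegree_coordwise !fctE affine_overlap_prodE mulrC.
by under [in RHS]eq_bigr do rewrite mul1r.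
Qed.

Lemma bmeasurable_correlation_coordwise x : correlation P coordwise p x \in bmeasurable.
Proof.
rewrite correlation_affine_overlap_prod.
by rewrite rpredM ?rpredB ?bmeasurable_cst ?bmeasurable_affine_overlap_prod.
Qed.

Lemma avgs_correlation_coordwise x : avgs P (enum C) (correlation P coordwise p x) = cst 0.
Proof.
have mprod := bmeasurable_affine_overlap_prod (1 - 2 * lam) 1 x.
rewrite correlation_affine_overlap_prod avgsZ ?avgsB ?rpredB ?bmeasurable_cst//.
rewrite avgs_cst avgs_affine_overlap_prod; apply/funext => y; rewrite !fctE exprAC.
by rewrite (_ : 1 - 2 * lam + 1 * lam ^+ 2 = tau ^+ 2) ?subrr ?mulr0//; ring.
Qed.

Variable eta : R.
Hypothesis lam_range : 0 <= lam <= 2^-1.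
Hypothesis p_range : 0 < p <= 2^-1.
Hypothesis eta_range : 0 < eta <= 1.
Hypothesis lam_sqr_le : #|C|%:R * lam ^+ 2 <= eta.
Hypothesis lam_le : 28 * lam <= eta.

Lemma avgs_correlation_coordwise_pow_le k x : k%:R * eta <= 1 ->
  avgs P (enum C) (fun y => (1 + correlation P coordwise p x y) ^+ k) x <=
  1 + 64 * (k%:R * p * eta) ^+ 2 * expR 28.
Proof.
move=> k_le; have [eta_gt0 _] := andP eta_range.
pose weight := affine_overlap_prod 1 (28 / eta) x.
pose scale : R := 64 * (k%:R * p * eta) ^+ 2.
have mcorr := bmeasurable_correlation_coordwise x.
have mweight : weight \in bmeasurable := bmeasurable_affine_overlap_prod 1 (28 / eta) x.
have mcst (c : R) : cst c \in @bmeasurable R _ X C := bmeasurable_cst _ _ c.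
have -> : (fun y => (1 + correlation P coordwise p x y) ^+ k) =
    (1 + correlation P coordwise p x) ^+ k.
  by apply/funext => y; rewrite exprfctE.
have pow_le y : ((1 + correlation P coordwise p x) ^+ k) y <=
    (1 + cst k%:R * correlation P coordwise p x + cst scale * weight) y.
  rewrite !(onerfctE, fctE) /weight affine_overlap_prodE correlation_coordwise.
  apply: exp1D_normalized_prod_le => //.
  - by move=> c; exact: overlap_range.
  - by rewrite subKr.
have closed := (mcst, mcorr, mweight, rpredD, rpredM, rpredX, rpred1).
apply: le_trans (avgs_le P _ _ _ pow_le x) _; rewrite ?closed//.
rewrite !avgsD ?avgsZ ?closed// [avgs P _ 1](avgs_cst P _ 1).
rewrite avgs_correlation_coordwise avgs_affine_overlap_prod !fctE mulr0 addr0 lerD2l.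
apply: ler_wpM2l; first by rewrite mulr_ge0 ?sqr_ge0.
have step_ge0 : 0 <= 28 / eta * lam ^+ 2 by rewrite mulr_ge0 ?sqr_ge0// divr_ge0// ltW.
apply: le_trans (expr1D_le_expR _ _) _; first by lra.
rewrite ler_expR (_ : _ * _ = 28 * (#|C|%:R * lam ^+ 2 / eta)); last by ring.
by rewrite ler_piMr// ler_pdivrMr// mul1r.
Qed.

Lemma sqr_sum_dist_graph_prob_le n (z0 : nat * C -> X) : n%:R * eta <= 1 ->
  (\sum_(G : row_graph n) `|graph_prob P coordwise z0 G - er_prob p G|) ^+ 2 <=
  256 * n%:R * (n%:R * p * eta) ^+ 2 * expR 28.
Proof.
move=> n_le; have [eta_gt0 _] := andP eta_range; have [p_gt0 p_le] := andP p_range.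
have p_lt1 : p < 1 by lra.
apply: le_trans (sqr_sum_dist_le_relative_entropy _ _ _ _) _.
- by move=> G; exact: graph_prob_ge0 measurable_coordwise _ _ _.
- by move=> G; exact: er_prob_gt0.
- exact: sum_graph_prob measurable_coordwise _ _.
- exact: sum_er_prob.
have -> : 256 * n%:R * (n%:R * p * eta) ^+ 2 * expR 28 =
    4 * (n%:R * (64 * (n%:R * p * eta) ^+ 2 * expR 28)) by ring.
rewrite ler_pM2l//.
apply: (graph_entropy_le coordwiseC measurable_coordwise coordwise_marginal) => // k x kn.
have k_le_n : k%:R <= n%:R :> R by rewrite ler_nat ltnW.
apply: le_trans (avgs_correlation_coordwise_pow_le _ _) _.
  by apply: le_trans n_le; rewrite ler_wpM2r// ltW.
have scale_ge0 j : 0 <= j%:R * p * eta by rewrite !mulr_ge0// ltW.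
rewrite lerD2l ler_wpM2r ?expR_ge0// ler_pM2l// lerXn2r ?nnegrE//.
by rewrite !ler_wpM2r// ltW.
Qed.

End CoordinatewiseGraph.

(** * The torus *)

Section IteratedIntegral.
Variable R : realType.
Local Notation circleR := (measurableTypeR R).

Let lt02 : (0 : R) < 2. Proof. exact: ltr0n. Qed.

Definition circle_prob : probability circleR R := uniform_prob lt02.

Lemma integral_circle_prob (f : circleR -> R) :
  measurable_fun setT f -> (forall t, 0 <= f t) ->
  (\int[circle_prob]_t (f t)%:E =
   (2^-1)%:E * \int[@lebesgue_measure R]_(t in `[0%R, 2%R[%classic) (f t)%:E)%E.
Proof.
move=> mf f_ge0; rewrite integral_uniform//; last exact/measurable_EFinP.
rewrite subr0 integral_itv_bndo_bndc//.
by apply/measurable_EFinP; exact: measurable_funTS.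
Qed.

Lemma iint_avgs (I : eqType) (s : seq I) (f : (I -> circleR) -> R) :
  uniq s -> f \in bmeasurable -> (forall z, 0 <= f z) ->
  iint s (fun z => (f z)%:E) = (avgs circle_prob s f (fun=> 0))%:E.
Proof.
elim: s f => //= i s ih f /andP[nis s_uniq] mf f_ge0.
have mavgs := bmeasurable_avgs circle_prob s mf.
rewrite EFin_avg// integral_circle_prob => [||t]; last exact: avgs_ge0.
  congr (_ * _)%E; apply: eq_integral => t _.
  rewrite -avgs_dfwith// -ih ?bmeasurable_dfwith//; congr (iint s _).
  apply/funext => z; congr (f _)%:E; apply/funext => j.
  by have [<-|ij] := eqVneq i j; rewrite ?eqxx ?dfwithin// dfwithout// eq_sym (negPf ij).
have /bmeasurableP[m _] := mavgs.
by apply: (m _ circleR (fun j t => dfwith (fun=> 0) i t j)) => j; exact: measurable_dfwith.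
Qed.

Lemma eq_iint (I : eqType) (s : seq I) (f g : (I -> R) -> \bar R) :
  (forall z, (forall i, 0 <= z i < 2) -> f z = g z) -> iint s f = iint s g.
Proof.
elim: s f g => [|i s ih] f g fg /=; first by apply: fg => _; rewrite lexx ltr0n.
congr (_ * _)%E; apply: eq_integral => t; rewrite inE /= in_itv /= => t02.
by apply: ih => z z02; apply: fg => j; case: eqP.
Qed.

Lemma iint_map (I I' : eqType) (phi : I -> I') (s : seq I) (f : (I -> R) -> \bar R) :
  injective phi -> iint (map phi s) (fun z => f (z \o phi)) = iint s f.
Proof.
move=> phi_inj; elim: s f => //= i s ih f.
congr (_ * _)%E; apply: eq_integral => t _.
rewrite -(ih (fun x => f (fun j => if j == i then t else x j))); congr iint.
by apply/funext => z; congr f; apply/funext => j /=; rewrite (inj_eq phi_inj).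
Qed.

Lemma unif_prob_avgs (I : finType) (I' : eqType) (phi : I -> I') (s : seq I')
    (Q : (I' -> circleR) -> bool) (Q0 : (I -> R) -> bool) :
  injective phi -> perm_eq s (map phi (enum I)) ->
  (fun z => (Q z)%:R : R) \in bmeasurable ->
  (forall z : I' -> R, (forall i, 0 <= z i < 2) -> Q0 (z \o phi) = Q z) ->
  unif_prob Q0 = avgs circle_prob s (fun z => (Q z)%:R) (fun=> 0).
Proof.
move=> phi_inj s_perm mQ QQ0; rewrite /unif_prob -(iint_map _ _ phi_inj).
rewrite (@eq_iint _ _ _ (fun z => ((Q z)%:R)%:E)) => [|z z02]; last by rewrite QQ0.
rewrite (iint_avgs (f := fun z => (Q z)%:R))//; last by rewrite map_inj_uniq ?enum_uniq.
by rewrite (perm_avgs circle_prob mQ s_perm).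
Qed.

End IteratedIntegral.

Section CircleKernel.
Context (R : realType).
Implicit Types (tau x y t : R).
Local Notation circleR := (measurableTypeR R).

(* Representatives outside the fundamental domain are sent to 0, so that the marginals of
   [circle_close] are constant on all of R. *)
Definition circle_rep x : R := if 0 <= x < 2 then x else 0.

Definition circle_close tau x y : bool := circd (circle_rep x) (circle_rep y) <= tau.

Lemma circdC x y : circd x y = circd y x.
Proof. by rewrite /circd distrC. Qed.

Lemma circle_closeC tau x y : circle_close tau x y = circle_close tau y x.
Proof. by rewrite /circle_close circdC. Qed.

Lemma circle_rep_id x : 0 <= x < 2 -> circle_rep x = x.
Proof. by rewrite /circle_rep => ->. Qed.

Lemma circle_rep_range x : 0 <= circle_rep x < 2.
Proof. by rewrite /circle_rep; case: ifP => //; rewrite lexx ltr0n. Qed.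

Lemma measurable_circle_rep : measurable_fun setT circle_rep.
Proof.
apply: measurable_fun_ifT => //.
by apply: measurable_and; [exact: measurable_fun_ler|exact: measurable_fun_ltr].
Qed.

Lemma measurable_circle_close tau : measurable_rel (circle_close tau : rel circleR).
Proof.
move=> d T f g mf mg; apply: measurable_fun_ler => //.
have mrf : measurable_fun setT (circle_rep \o f).
  by apply: measurableT_comp mf; exact: measurable_circle_rep.
have mrg : measurable_fun setT (circle_rep \o g).
  by apply: measurableT_comp mg; exact: measurable_circle_rep.
by apply: measurable_minr; [|apply: measurable_funB => //];
  apply: measurableT_comp => //; exact: measurable_funB.
Qed.

Lemma lebesgue_measure_bounded_itv (bl br : bool) (a b : R) : a <= b ->
  lebesgue_measure [set` Interval (BSide bl a) (BSide br b)] = (b - a)%:E.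
Proof.
move=> ab; rewrite lebesgue_measure_itv /= lte_fin.
by case: ltgtP ab => // -> _; rewrite subrr.
Qed.

Definition circle_far tau x : set R := `[0, 2[ `&` [set t | tau < circd x t].

Lemma circle_farE tau x : 0 <= tau -> circle_far tau x =
  `[0, 2[ `&` (`]x + tau, x + 2 - tau[ `|` `]x - 2 + tau, x - tau[).
Proof.
move=> tau_ge0; rewrite /circle_far; congr (_ `&` _); apply/seteqP; split=> t /=.
  rewrite !in_itv /= /circd lt_min; case: (lerP t x) => tx /andP[far_left far_right].
    by right; lra.
  by left; lra.
rewrite !in_itv /= /circd lt_min; case: (lerP t x) => tx; lra.
Qed.

Lemma lebesgue_measure_circle_far tau x : 0 <= tau <= 1 -> 0 <= x < 2 ->
  lebesgue_measure (circle_far tau x) = (2 - 2 * tau)%:E.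
Proof.
move=> /andP[tau_ge0 tau_le1] /andP[x_ge0 x_lt2]; rewrite circle_farE//.
have [x_le|x_gt] := leP x tau.
  rewrite (_ : _ `&` _ = `]x + tau, x + 2 - tau[%classic).
    by rewrite lebesgue_measure_bounded_itv; [congr EFin; ring|lra].
  by apply/seteqP; split=> t /=; rewrite !in_itv /=; lra.
have [x_ge|x_lt] := leP 2 (x + tau).
  rewrite (_ : _ `&` _ = `]x - 2 + tau, x - tau[%classic).
    by rewrite lebesgue_measure_bounded_itv; [congr EFin; ring|lra].
  by apply/seteqP; split=> t /=; rewrite !in_itv /=; lra.
rewrite (_ : _ `&` _ = `[0, x - tau[%classic `|` `]x + tau, 2[%classic).
  rewrite measureU//=; last first.
    by rewrite -subset0 => t [] /=; rewrite !in_itv /=; lra.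
  rewrite [X in (X + _)%E]lebesgue_measure_bounded_itv; last by lra.
  rewrite [X in (_ + X)%E]lebesgue_measure_bounded_itv; last by lra.
  by rewrite -EFinD; congr EFin; ring.
by apply/seteqP; split=> t /=; rewrite !in_itv /=; lra.
Qed.

Lemma circle_probE (A : set circleR) : measurable A ->
  circle_prob R A = ((2^-1)%:E * lebesgue_measure (`[0%R, 2%R[ `&` A))%E.
Proof.
move=> mA; rewrite -[in LHS](setIT A) -integral_indic// integral_circle_prob//.
by rewrite integral_indic// setIC.
Qed.

Lemma circle_close_marginal tau x : 0 <= tau <= 1 ->
  \int[circle_prob R]_t ((circle_close tau x t)%:R : R) = tau.
Proof.
move=> tau01; pose near : set circleR := [set t | circle_close tau x t].
have mnear : measurable near.
  have mclose : measurable_fun setT (fun t : circleR => circle_close tau x t).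
    by apply: measurable_circle_close => //; exact: measurable_cst.
  by rewrite -[near]setTI; exact: (mclose measurableT [set true]).
have far_prob : circle_prob R (~` near) = (1 - tau)%:E.
  rewrite circle_probE; last exact: measurableC.
  rewrite (_ : _ `&` _ = circle_far tau (circle_rep x)).
    by rewrite lebesgue_measure_circle_far ?circle_rep_range// -EFinM; congr EFin; lra.
  apply/seteqP; split=> t [t02]; have := t02; rewrite /= in_itv /= => t_range;
    rewrite /near /circle_close /= (circle_rep_id t_range).
    by move/negP; rewrite -ltNge; split.
  by rewrite ltNge => /negP.
rewrite /Rintegral (eq_integral (fun t : circleR => (\1_near t)%:E)) => [|t _]; last first.
  by rewrite indicE; congr ((nat_of_bool _)%:R)%:E; apply/idP/idP; rewrite inE.
rewrite integral_indic// setIT.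
have := probability_setC (circle_prob R) (measurableC mnear).
by rewrite setCK far_prob -EFinB subKr => /(congr1 fine).
Qed.

End CircleKernel.

Section EdgeSets.
Local Close Scope classical_set_scope.
Variable n : nat.
Implicit Types (E : graph_on n) (i j : 'I_n).

Definition pairs : graph_on n := [set e : {set 'I_n} | #|e| == 2%N].

Definition edge_rel E (i j : nat) : bool :=
  [set k : 'I_n | (k == i :> nat) || (k == j :> nat)] \in E.

Lemma edge_relE E i j : edge_rel E i j = ([set i; j] \in E).
Proof. by congr (_ \in E); apply/setP => k; rewrite !inE. Qed.

Lemma set2_ltn_inj i j i' j' : (i < j)%N -> (i' < j')%N ->
  [set i; j] = [set i'; j'] -> (i, j) = (i', j').
Proof.
move=> ij ij' eq_set2.
have : i \in [set i'; j'] by rewrite -eq_set2 set21.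
have : j \in [set i'; j'] by rewrite -eq_set2 set22.
rewrite !inE => /orP[]/eqP jE /orP[]/eqP iE; move: ij ij'; rewrite jE iE ?ltnn//.
by move=> /ltn_trans lt_trans /lt_trans; rewrite ltnn.
Qed.

Lemma pairsP e : reflect (exists i j, (i < j)%N /\ e = [set i; j]) (e \in pairs).
Proof.
rewrite inE; apply: (iffP idP) => [/cards2P[i [j [ij ->]]]|[i [j [ij ->]]]].
  move: ij; rewrite -val_eqE neq_ltn => /orP[ij|ji]; first by exists i, j.
  by exists j, i; rewrite finset.setUC.
by rewrite cards2 neq_ltn ij.
Qed.

Lemma eq_edge_sets E E' : E \subset pairs -> E' \subset pairs ->
  (forall i j, (i < j)%N -> ([set i; j] \in E) = ([set i; j] \in E')) -> E = E'.
Proof.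
move=> /fintype.subsetP EU /fintype.subsetP EU' EE'; apply/setP => e.
have [/pairsP[i [j [ij ->]]]|eU] := boolP (e \in pairs); first exact: EE'.
by rewrite (negPf (contra (EU e) eU)) (negPf (contra (EU' e) eU)).
Qed.

Definition edge_rows E : row_graph n := rows_of n (edge_rel E).

Lemma edge_rows_inj : {in [pred E : graph_on n | E \subset pairs] &, injective edge_rows}.
Proof.
move=> E E' EU EU' /rows_ofP EE'; apply: eq_edge_sets => // i j ij.
by rewrite -!edge_relE EE'.
Qed.

Lemma prod_pairs (R : realType) (F : {set 'I_n} -> R) :
  \prod_(e in pairs) F e = \prod_(j < n) \prod_(i < n | (i < j)%N) F [set i; j].
Proof.
pose ordered := [set x : 'I_n * 'I_n | (x.2 < x.1)%N].
have -> : pairs = [set [set x.2; x.1] | x in ordered].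
  apply/setP => e; apply/pairsP/imsetP => [[i [j [ij ->]]]|[x]].
    by exists (j, i); rewrite ?inE.
  by rewrite inE => x21 ->; exists x.2, x.1.
rewrite big_imset /= => [|[x1 x2] [y1 y2]]; last first.
  by rewrite !inE /= => x21 y21 /(set2_ltn_inj x21 y21)[-> ->].
by rewrite pair_big_dep /=; apply: eq_bigl => x; rewrite inE.
Qed.

Lemma er_law_edge_rows (R : realType) (p : R) E : E \subset pairs ->
  er_law p E = er_prob p (edge_rows E).
Proof.
move=> EU; rewrite /er_law EU /edge_rows er_prob_rows_of.
transitivity (\prod_(e in pairs) bernoulli_pmf p (e \in E)); last first.
  by rewrite prod_pairs; apply: eq_bigr => j _; apply: eq_bigr => i _; rewrite edge_relE.
rewrite (big_setID E) /= (finset.setIidPr EU); congr (_ * _).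
  by rewrite (eq_bigr (fun=> p)) ?prodr_const// => e ->.
rewrite (eq_bigr (fun=> 1 - p)) => [|e]; last by rewrite inE => /andP[/negPf-> _].
rewrite prodr_const cardsD (finset.setIidPr EU); congr (_ ^+ (_ - _)).
by rewrite card_draws card_ord.
Qed.

Lemma rgg_graph_subset_pairs (R : realType) d (tau : R) z :
  rgg_graph (n := n) (d := d) tau z \subset pairs.
Proof.
apply/fintype.subsetP => e; rewrite inE => /existsP[i /existsP[j /and3P[ij /eqP -> _]]].
by apply/pairsP; exists i, j.
Qed.

Lemma mem_rgg_graph (R : realType) d (tau : R) z i j : (i < j)%N ->
  ([set i; j] \in rgg_graph (d := d) tau z) =
  (linf (fun k => z (i, k)) (fun k => z (j, k)) <= tau).
Proof.
move=> ij; rewrite inE; apply/existsP/idP => [[i' /existsP[j']]|linked].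
  by move=> /and3P[ij' /eqP /(set2_ltn_inj ij ij')[-> ->]].
by exists i; apply/existsP; exists j; rewrite ij eqxx.
Qed.

End EdgeSets.

Section TorusGraph.
Context (R : realType).
Variables (d : nat) (tau : R).
Hypothesis tau01 : 0 <= tau <= 1.

Local Notation circleR := (measurableTypeR R).
Local Notation P := (circle_prob R).
Local Notation torus_close := (@coordwise _ circleR (@circle_close R tau) 'I_d).
Local Notation p := (tau ^+ d).

Let measurable_nbr : measurable_rel (@circle_close R tau : rel circleR).
Proof. exact: measurable_circle_close. Qed.

Lemma linf_le m (x y : 'I_m -> R) (t : R) : 0 <= t ->
  (linf x y <= t) = [forall k, circd (x k) (y k) <= t].
Proof.
move=> t_ge0; apply/idP/forallP => [le_t k|le_t].
  by apply: le_trans le_t; exact: le_bigmax.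
by apply/bigmax_leP; split.
Qed.

Lemma linf_coordwise (x y : 'I_d -> R) :
  (forall k, 0 <= x k < 2) -> (forall k, 0 <= y k < 2) -> (linf x y <= tau) = torus_close x y.
Proof.
move=> x02 y02; rewrite linf_le; last by case/andP: tau01.
by apply: eq_forallb => k; rewrite /circle_close !circle_rep_id.
Qed.

Lemma torus_close_marginal x : avgs P (enum 'I_d) (fun y => (torus_close x y)%:R) = cst p.
Proof.
rewrite (coordwise_marginal (tau := tau) measurable_nbr) ?card_ord// => t.
exact: circle_close_marginal.
Qed.

Lemma edge_probE : edge_prob d tau = p.
Proof.
pose phi (x : bool * 'I_d) : nat * 'I_d := (nat_of_bool x.1, x.2).
have eqindE : (fun z => (adj torus_close 0 1 z)%:R) = eqind R (adj torus_close 0 1) true.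
  by apply/funext => z; rewrite /eqind eqb_id.
rewrite /edge_prob (@unif_prob_avgs R _ _ phi (first_coords _ 2) (adj torus_close 0 1)).
- rewrite eqindE -/(expect P 2 _) expectS.
  rewrite (vavg_adj (p := p))//; last exact: torus_close_marginal.
  by rewrite /expect avgs_cst.
- by move=> [[] k] [[] k'] // [->].
- apply: uniq_perm; first exact: first_coords_uniq.
    by rewrite map_inj_uniq ?enum_uniq// => -[[] k] [[] k'] // [->].
  move=> [v k]; rewrite mem_first_coords /=; apply/idP/mapP => [v2|[[e k'] _ [-> _]]].
    by exists (v == 1%N, k); rewrite ?mem_enum//; case: v v2 => [|[|]].
  by case: e.
- by rewrite eqindE; exact: bmeasurable_adj (measurable_coordwise measurable_nbr) _ _ _.
- by move=> z z02; apply: linf_coordwise => k; exact: z02.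
Qed.

Variable n : nat.

Definition ord_vertex (x : 'I_n * 'I_d) : nat * 'I_d := (nat_of_ord x.1, x.2).

Lemma ord_vertex_inj : injective ord_vertex.
Proof. by move=> [i k] [i' k'] [/val_inj -> ->]. Qed.

Lemma perm_first_coords :
  perm_eq (first_coords 'I_d n) (map ord_vertex (enum {: 'I_n * 'I_d})).
Proof.
apply: uniq_perm; first exact: first_coords_uniq.
  by rewrite map_inj_uniq ?enum_uniq//; exact: ord_vertex_inj.
move=> [v k]; rewrite mem_first_coords /=; apply/idP/mapP => [vn|[[i k'] _ [-> _]]//].
by exists (Ordinal vn, k); rewrite ?mem_enum.
Qed.

Lemma edge_rows_rgg_graph (z : nat * 'I_d -> R) : (forall i, 0 <= z i < 2) ->
  edge_rows (rgg_graph tau (z \o ord_vertex)) = sample_graph torus_close n z.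
Proof.
move=> z02; apply/rows_ofP => i j ij jn; have iN := ltn_trans ij jn.
rewrite (edge_relE _ (Ordinal iN) (Ordinal jn)) mem_rgg_graph//.
by apply: linf_coordwise => k; exact: z02.
Qed.

Lemma rgg_law_edge_rows (E : graph_on n) : E \subset pairs n ->
  rgg_law d tau E = graph_prob P torus_close (fun=> 0) (edge_rows E).
Proof.
move=> EU; rewrite /rgg_law (@unif_prob_avgs R _ _ ord_vertex (first_coords 'I_d n)
  (fun z => sample_graph torus_close n z == edge_rows E)) //.
- exact: ord_vertex_inj.
- exact: perm_first_coords.
- exact: bmeasurable_sample_graph (measurable_coordwise measurable_nbr) _ _.
- move=> z z02; rewrite -edge_rows_rgg_graph//; apply/eqP/eqP => [->//|].
  by apply: edge_rows_inj; rewrite ?inE ?rgg_graph_subset_pairs.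
Qed.

Lemma rgg_law_eq0 (E : graph_on n) : ~~ (E \subset pairs n) -> rgg_law d tau E = 0.
Proof.
move=> EU; rewrite /rgg_law.
rewrite (@unif_prob_avgs R _ _ ord_vertex (first_coords 'I_d n) (fun=> false)).
- by rewrite (avgs_cst _ _ 0).
- exact: ord_vertex_inj.
- exact: perm_first_coords.
- exact: bmeasurable_cst.
- by move=> z _; apply: contraNF EU => /eqP <-; exact: rgg_graph_subset_pairs.
Qed.

Lemma tv_rgg_er_le_sum : tv_rgg_er n d p tau <=
  2^-1 * \sum_(G : row_graph n) `|graph_prob P torus_close (fun=> 0) G - er_prob p G|.
Proof.
pose dist (G : row_graph n) := `|graph_prob P torus_close (fun=> 0) G - er_prob p G|.
pose A : {set graph_on n} := [set E : graph_on n | E \subset pairs n]%SET.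
have sumE : \sum_(E : graph_on n) `|rgg_law d tau E - er_law p E| =
    \sum_(E in A) dist (edge_rows E).
  rewrite (bigID (mem A)) /= [X in _ + X]big1 ?addr0 => [|E].
    apply: eq_bigr => E; rewrite inE => EU.
    by rewrite /dist rgg_law_edge_rows// er_law_edge_rows.
  by rewrite inE => EU; rewrite rgg_law_eq0// /er_law (negPf EU) subr0 normr0.
rewrite /tv_rgg_er sumE ler_pM2l ?invr_gt0//.
rewrite -(big_imset dist) /= => [|E E']; last by rewrite !inE; exact: edge_rows_inj.
rewrite -/(\sum_G dist G) [leRHS](bigID (mem [set edge_rows E | E in A]%SET)) /=.
by rewrite lerDl sumr_ge0// => G _; exact: normr_ge0.
Qed.

Lemma tv_rgg_er_le_scale (eta : R) : 0 <= 1 - tau <= 2^-1 -> 0 < p <= 2^-1 ->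
  0 < eta <= 1 -> d%:R * (1 - tau) ^+ 2 <= eta -> 28 * (1 - tau) <= eta -> n%:R * eta <= 1 ->
  tv_rgg_er n d p tau <= 8 * expR 14 * (n%:R `^ (3 / 2) * p * eta).
Proof.
move=> lam_range p_range eta_range lam_sqr_le lam_le n_le.
have [[p_gt0 _] [eta_gt0 _]] := (andP p_range, andP eta_range).
apply: le_trans tv_rgg_er_le_sum _.
rewrite (_ : 8 * _ * _ = 2^-1 * (16 * expR 14 * (n%:R `^ (3 / 2) * p * eta))); last by field.
rewrite ler_pM2l ?invr_gt0// -(@ler_pXn2r _ 2) ?nnegrE//; last 2 first.
- by apply: sumr_ge0 => G _; exact: normr_ge0.
- by rewrite !mulr_ge0 ?expR_ge0 ?powR_ge0// ltW.
have -> : (16 * expR 14 * (n%:R `^ (3 / 2) * p * eta)) ^+ 2 =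
    256 * n%:R * (n%:R * p * eta) ^+ 2 * expR 28.
  have powR_sqr : (n%:R `^ (3 / 2) : R) ^+ 2 = n%:R ^+ 3.
    by rewrite -powR_mulrn ?powR_ge0// -powRrM divfK// powR_mulrn.
  rewrite (_ : 28 = 2 * 14); last by ring.
  by rewrite expRM_natl !exprMn powR_sqr; ring.
have := @sqr_sum_dist_graph_prob_le R _ circleR P (circle_close tau) tau 'I_d
  (@circle_closeC R tau) measurable_nbr (fun x => circle_close_marginal x tau01) eta.
by rewrite card_ord; apply.
Qed.

End TorusGraph.

Section Threshold.
Context (R : realType).
Implicit Types (d n : nat) (tau p x y : R).

Lemma edge_prob_lt0 d tau : tau < 0 -> edge_prob d tau = 0.
Proof.
move=> tau_lt0; rewrite /edge_prob.
rewrite (@unif_prob_avgs R _ _ id _ (fun=> false) _ _ (perm_refl _)) //.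
- by rewrite (avgs_cst _ _ 0).
- exact: bmeasurable_cst.
- by move=> z _; apply/negbTE; rewrite -ltNge (lt_le_trans tau_lt0)//; exact: bigmax_ge_id.
Qed.

Lemma edge_prob_gt1 d tau : 1 < tau -> edge_prob d tau = 1.
Proof.
move=> tau_gt1; rewrite /edge_prob.
rewrite (@unif_prob_avgs R _ _ id _ (fun=> true) _ _ (perm_refl _)) //.
- by rewrite (avgs_cst _ _ 1).
- exact: bmeasurable_cst.
- move=> z _; rewrite linf_le; last by lra.
  apply/forallP => k; apply: le_trans (ltW tau_gt1); rewrite /circd ge_min.
  by case: lerP => //= ?; lra.
Qed.

Lemma edge_prob_inv d tau : 0 < edge_prob d tau <= 2^-1 ->
  0 <= tau <= 1 /\ edge_prob d tau = tau ^+ d.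
Proof.
move=> /andP[prob_gt0 prob_le]; suff tau01 : 0 <= tau <= 1 by rewrite edge_probE.
apply/andP; split; rewrite leNgt; apply/negP => tau_out.
  by rewrite edge_prob_lt0// ltxx in prob_gt0.
by rewrite edge_prob_gt1// in prob_le; lra.
Qed.

Lemma mulrn_subr_le_ln d tau : 0 < tau -> d%:R * (1 - tau) <= - ln (tau ^+ d).
Proof.
move=> tau_gt0; rewrite lnXn// -[ln tau *+ d]mulr_natl -mulrN ler_wpM2l//.
by have := ln_le_subr1 tau_gt0; lra.
Qed.

Lemma le_ln x y : expR x <= y -> x <= ln y.
Proof.
by move=> xy; rewrite -[leLHS]expRK ler_ln ?posrE ?expR_gt0// (lt_le_trans (expR_gt0 x)).
Qed.

Lemma tv_rgg_er_le n d p tau :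
  expR 28 <= n%:R :> R -> n%:R^-1 <= p <= 2^-1 -> edge_prob d tau = p ->
  n%:R * ln (n%:R : R) ^+ 2 <= d%:R ->
  tv_rgg_er n d p tau <= 8 * expR 14 * (n%:R `^ (3 / 2) * p * (ln (n%:R : R) ^+ 2 / d%:R)).
Proof.
move=> n_ge /andP[p_ge p_le] prob_p d_ge.
have n_gt0 : 0 < n%:R :> R := lt_le_trans (expR_gt0 _) n_ge.
have n_ge1 : 1 <= n%:R :> R by rewrite ler1n -(ltr0n R).
have p_gt0 : 0 < p by rewrite (lt_le_trans _ p_ge) ?invr_gt0.
have [tau01 p_def] : 0 <= tau <= 1 /\ p = tau ^+ d.
  by rewrite -prob_p; apply: edge_prob_inv; rewrite prob_p p_gt0.
set L := ln (n%:R : R).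
have L_ge28 : 28 <= L := le_ln n_ge.
have L_gt0 : 0 < L by lra.
have d_gt0 : 0 < d%:R :> R by apply: lt_le_trans d_ge; rewrite mulr_gt0// exprn_gt0.
have tau_gt0 : 0 < tau.
  rewrite lt_def; case/andP: tau01 => -> _; rewrite andbT; apply: contraTneq p_gt0 => tau0.
  by rewrite p_def tau0 expr0n eqn0Ngt -(ltr0n R) d_gt0 ltxx.
have lam_ge0 : 0 <= 1 - tau by case/andP: tau01 => _; lra.
have dlam_le : d%:R * (1 - tau) <= L.
  apply: le_trans (mulrn_subr_le_ln _ tau_gt0) _; rewrite -p_def -lnV//.
  by rewrite ler_ln ?posrE ?invr_gt0// -[leRHS]invrK lef_pV2 ?posrE ?invr_gt0.
have eta_gt0 : 0 < L ^+ 2 / d%:R by rewrite divr_gt0// exprn_gt0.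
have n_eta_le1 : n%:R * (L ^+ 2 / d%:R) <= 1 by rewrite mulrA ler_pdivrMr// mul1r.
have eta_le1 : L ^+ 2 / d%:R <= 1 by apply: le_trans n_eta_le1; rewrite ler_peMl// ltW.
have lam_le : 28 * (1 - tau) <= L ^+ 2 / d%:R.
  rewrite ler_pdivlMr// -mulrA [_ * d%:R]mulrC expr2.
  by rewrite ler_pM ?mulr_ge0.
rewrite p_def; apply: tv_rgg_er_le_scale => //.
- by rewrite lam_ge0 /=; lra.
- by rewrite -p_def p_gt0.
- by rewrite eta_gt0.
- rewrite ler_pdivlMr// (_ : _ * d%:R = (d%:R * (1 - tau)) ^+ 2); last by ring.
  by rewrite lerXn2r ?nnegrE ?mulr_ge0//; lra.
Qed.

Lemma tv_rgg_er_ge0 n d p tau : 0 <= tv_rgg_er n d p tau.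
Proof. by rewrite mulr_ge0 ?sumr_ge0. Qed.

Lemma le_div_max (M a b c D : R) : 1 <= M -> 0 < b -> 0 < c ->
  M <= D / (Num.max a b * c) -> b * c <= D /\ a * (c / D) <= M^-1.
Proof.
move=> M_ge1 b_gt0 c_gt0; have M_gt0 : 0 < M by lra.
have maxc_gt0 : 0 < Num.max a b * c by rewrite mulr_gt0// lt_max b_gt0 orbT.
rewrite ler_pdivlMr// => D_ge.
have D_gt0 : 0 < D := lt_le_trans (mulr_gt0 M_gt0 maxc_gt0) D_ge; split.
  apply: le_trans D_ge; apply: le_trans (ler_peMl (ltW maxc_gt0) M_ge1).
  by rewrite ler_pM2r// le_max lexx orbT.
rewrite mulrA ler_pdivrMr// ler_pdivlMl//; apply: le_trans D_ge.
by rewrite ler_pM2l// ler_pM2r// le_max lexx.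
Qed.

Lemma tv_rgg_er_le_inv (M : R) n d p tau : 1 <= M ->
  expR 28 <= n%:R :> R -> n%:R^-1 <= p <= 2^-1 -> edge_prob d tau = p ->
  M <= d%:R / (Num.max (n%:R `^ (3 / 2) * p) n%:R * ln (n%:R : R) `^ 2) ->
  tv_rgg_er n d p tau <= 8 * expR 14 / M.
Proof.
move=> M_ge1 n_ge p_range prob_p d_large.
have n_gt0 : 0 < n%:R :> R := lt_le_trans (expR_gt0 _) n_ge.
have ln_gt0 : 0 < ln (n%:R : R) by apply: lt_le_trans (le_ln n_ge).
rewrite (powR_mulrn 2 (ltW ln_gt0)) in d_large.
have [d_ge scale_le] := le_div_max M_ge1 n_gt0 (exprn_gt0 2 ln_gt0) d_large.
apply: le_trans (tv_rgg_er_le n_ge p_range prob_p d_ge) _.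
by rewrite ler_wpM2l// mulr_ge0 ?expR_ge0.
Qed.

End Threshold.

Unset Implicit Arguments.

Theorem theorem1p2 (R : realType) (delta eps : R) :
  0 < delta -> 0 < eps ->
  exists C : R, 0 <= C /\
  forall (p : nat -> R) (d : nat -> nat) (tau : nat -> R),
    (* Assumption (A) *)
    (\forall n \near \oo,
        (n%:R `^ (eps - 1) <= p n) /\ (p n <= 2^-1) /\ (n%:R `^ delta <= (d n)%:R)) ->
    (* tau n = tau^oo_p for the parameters (n, d n, p n) *)
    (\forall n \near \oo, edge_prob (d n) (tau n) = p n) ->
    (* d = omega~( max(n^{3/2} p, n) ), polylog factor (ln n)^C *)
    (forall M : R, \forall n \near \oo,
        M <= (d n)%:R /
             (Num.max (n%:R `^ (3 / 2) * p n) n%:R * (ln (n%:R : R)) `^ C)) ->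
    (fun n => tv_rgg_er n (d n) (p n) (tau n)) @ \oo --> (0 : R).
Proof.
move=> _ eps_gt0; exists 2; split=> // p d tau assumption_A prob_tau d_large.
apply/cvgrPdist_le => e e_gt0; pose K : R := 8 * expR 14.
have K_gt0 : 0 < K by rewrite mulr_gt0 ?expR_gt0.
near=> n.
have n_ge : expR 28 <= n%:R :> R by near: n; exact: nbhs_infty_ger.
have n_gt0 : 0 < n%:R :> R := lt_le_trans (expR_gt0 _) n_ge.
have n_ge1 : 1 <= n%:R :> R by rewrite ler1n -(ltr0n R).
have [p_ge [p_le _]] : n%:R `^ (eps - 1) <= p n /\ p n <= 2^-1 /\ n%:R `^ delta <= (d n)%:R.
  by near: n.
rewrite sub0r normrN ger0_norm ?tv_rgg_er_ge0//.
apply: (@le_trans _ _ (K / (K / e + 1))).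
  apply: tv_rgg_er_le_inv => //.
  - by rewrite lerDr divr_ge0// ltW.
  - by rewrite p_le andbT (le_trans _ p_ge)// -(powR_inv1 (ltW n_gt0)) ler_powR//; lra.
  - by near: n.
  - by near: n; exact: d_large.
rewrite ler_pdivrMr ?addr_gt0 ?divr_gt0//.
by rewrite mulrDr mulr1 mulrC divfK ?gt_eqF// lerDl ltW.
Unshelve. all: by end_near.
Qed.
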